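(* For $n\in\mathbb{N}$ let $(U_j^{(n)})_{j\in\mathbb{N}}$ be independent random variables, each uniformly distributed on $[n]=\{1,\dots,n\}$. For $1\le m\le n$ let $\tau^{(n)}(m)$ be the smallest $j$ such that there are exactly $m$ distinct values among $U_1^{(n)},\dots,U_j^{(n)}$, set $\tau^{(n)}(m):=\tau^{(n)}(n)$ for $m>n$, and let $B_n(m):=\{U_1^{(n)},\dots,U_{\tau^{(n)}(m)}^{(n)}\}$. Let $(\mathcal{G}_k(p))_{k\in\mathbb{N},\,p\ \text{prime}}$ be independent with $\mathbb{P}\{\mathcal{G}_k(p)\ge j\}=p^{-j}$ for $j\in\mathbb{N}_0$, and let $(U_j)_{j\ge1}$ be independent uniform on $[0,1]$, independent of the $\mathcal{G}_k(p)$. Then, as $n\to\infty$, $$\Bigl(\log{\rm lcm}(B_n(m))-m\log n\Bigr)_{m\in\mathbb{N}}$$ converges in distribution in $\mathbb{R}^\infty$ with the product topology to $$\Bigl(\sum_{j=1}^m\log U_j+\sum_{p\ \text{prime}}\log p\cdot\Bigl(\max_{1\le k\le m}\mathcal{G}_k(p)-\sum_{k=1}^m\mathcal{G}_k(p)\Bigr)\Bigr)_{m\in\mathbb{N}}.$$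
   Context: ${\rm lcm}$ denotes least common multiple. For each $m\le n$, $B_n(m)$ is a uniformly random $m$-element subset of $[n]$. *)

(* Defs.v *)
From HB Require Import structures.
From mathcomp Require Import all_boot all_order all_algebra.
From mathcomp Require Import all_classical all_reals all_analysis.
Set Implicit Arguments. Unset Strict Implicit. Unset Printing Implicit Defensive.
Import Order.TTheory GRing.Theory Num.Theory.
Import numFieldNormedType.Exports.
Local Open Scope classical_set_scope.
Local Open Scope ring_scope.

Definition mutual_indep d (T : measurableType d) (R : realType)
  (P : probability T R) (I : eqType) (D : pred I) (X : I -> T -> R) : Prop :=
  (forall i, D i -> measurable_fun setT (X i)) /\
  (forall (J : seq I) (B : I -> set R), uniq J -> (forall i, i \in J -> D i) ->
     (forall i, measurable (B i)) ->
     P (\bigcap_(i in [set i | i \in J]) (X i @^-1` B i)) =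
     (\prod_(i <- J) P (X i @^-1` B i))%E).

(** number of distinct values among u 0, ..., u (j-1)
    (u i plays the role of U_{i+1}) *)
Definition distinct_upto (u : nat -> nat) (j : nat) : nat :=
  size (undup [seq u i | i <- iota 0 j]).

(** smallest j such that u 0, ..., u (j-1) contain exactly m distinct values
    (0 if no such j exists, a null event in our application) *)
Definition first_time (u : nat -> nat) (m : nat) : nat :=
  match pselect (exists j, distinct_upto u j == m) with
  | left h => @ex_minn (fun j => distinct_upto u j == m) h
  | right _ => 0%N
  end.

Definition tau (n : nat) (u : nat -> nat) (m : nat) : nat :=
  first_time u (minn m n).

Definition Bset (n : nat) (u : nat -> nat) (m : nat) : seq nat :=
  undup [seq u i | i <- iota 0 (tau n u m)].

Definition lcm_seq (s : seq nat) : nat := \big[lcmn/1%N]_(x <- s) x.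

(** the prelimit vector, coordinate m (0-based) corresponds to m.+1 *)
Definition lcm_vector (R : realType) (n : nat) (u : nat -> nat) : nat -> R :=
  fun m => ln ((lcm_seq (Bset n u m.+1))%:R : R) - (m.+1)%:R * ln (n%:R : R).

(** the limit vector; g k p = G_{k+1}(p), v j = U_{j+1};
    the sum over all primes is the limit of the partial sums over p < N *)
Definition limit_vector (R : realType) (g : nat -> nat -> nat) (v : nat -> R)
  : nat -> R :=
  fun m => \sum_(j < m.+1) ln (v j) +
    limn (fun N : nat => \sum_(p < N | prime p)
      ln (p%:R : R) * ((\max_(k < m.+1) g k p)%:R - (\sum_(k < m.+1) g k p)%:R)).

(* Main.v *)
(** Since U_1, ..., U_m are distinct with probability 1 - O(1/n), B_n(m) may be
    replaced by an i.i.d. uniform sample, for which log lcm - m log n equals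
    sum_j log(U_j/n) + sum_p log p (max_j v_p(U_j) - sum_j v_p(U_j)), with v_p
    the p-adic valuation.  Rounding U_j/n up to the grid of mesh 1/(k+1), capping
    valuations at k and keeping only primes p <= k gives finite-valued vectors.
    For fixed k their law converges as n -> oo, because the density of multiples
    of d in an interval of [n] is 1/d and the indicator of v_p = e is a
    difference of two divisibility indicators.  The approximation is good
    uniformly in n: a prime p > k contributes only if it divides two of the U_j,
    an event of probability O(sum_{p>k} 1/p^2) = O(1/k).  The same event, via
    Borel-Cantelli, makes the limiting sum over primes almost surely finite. *)

Require Import Defs.
From HB Require Import structures.
From mathcomp Require Import all_boot all_order all_algebra.
From mathcomp Require Import all_classical all_reals all_analysis.
From mathcomp Require Import measurable_realfun.
From mathcomp Require Import ring lra zify.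
Set Implicit Arguments. Unset Strict Implicit. Unset Printing Implicit Defensive.
Import Order.TTheory GRing.Theory Num.Theory.
Import numFieldNormedType.Exports.
Local Open Scope classical_set_scope.
Local Open Scope ring_scope.

(** * Bounded integrals *)

Section BoundedIntegrals.
Context (d : measure_display) (T : measurableType d) (R : realType).
Context (P : probability T R).
Implicit Types (f g h e p q : T -> R) (A N : set T).

(** The integrands are [f] applied to vectors built from an lcm of a random set and from a [limn] of
    partial sums. Their measurability is bypassed: such a function is only ever compared with a
    measurable one, up to a measurable error. All laws are computed on vectors that factor through
    the finite type [grid k]. There every test function is measurable, and convergence in law means
    convergence of finitely many probabilities, so it holds for discontinuous test functions too.
    This takes the place of tightness. A continuous [f] on the infinite product has no uniform
    modulus, and the scale at which it varies little depends on the point. The set of points where a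
    prescribed scale fails can however be tested directly on the discrete vectors: it is rare for
    the discretized limit, hence rare for the discretized sample, whose closeness to the true vector
    then controls [f]. *)

Definition bounded_mfun f :=
  measurable_fun setT f /\ exists M : R, forall w, `|f w| <= M.

Lemma bounded_mfun_integrable f :
  bounded_mfun f -> P.-integrable setT (EFin \o f).
Proof.
move=> [mf [M fM]]; apply: measurable_bounded_integrable => //.
- by rewrite /= probability_setT ltry.
- exists M; split; first exact: num_real.
  by move=> x Mx w _; rewrite /= (le_trans (fM w)) // ltW.
Qed.

Lemma bounded_mfunD f g :
  bounded_mfun f -> bounded_mfun g -> bounded_mfun (fun w => f w + g w).
Proof.
move=> [mf [M fM]] [mg [M' gM]]; split; first exact: measurable_funD.
by exists (M + M') => w; rewrite (le_trans (ler_normD _ _)) // lerD.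
Qed.

Lemma bounded_mfunZ (c : R) f :
  bounded_mfun f -> bounded_mfun (fun w => c * f w).
Proof.
move=> [mf [M fM]]; split; first exact: measurable_funM.
by exists (`|c| * M) => w; rewrite normrM ler_wpM2l.
Qed.

Lemma bounded_mfunB f g :
  bounded_mfun f -> bounded_mfun g -> bounded_mfun (fun w => f w - g w).
Proof.
move=> bf /(bounded_mfunZ (-1)) bg; have := bounded_mfunD bf bg.
by under eq_fun do rewrite mulN1r.
Qed.

Lemma bounded_mfun_cst (c : R) : bounded_mfun (fun=> c).
Proof. by split; [exact: measurable_cst | exists `|c|]. Qed.

Lemma bounded_mfun_indic A : measurable A -> bounded_mfun (\1_A).
Proof.
move=> mA; split; first exact: measurable_indic.
by exists 1 => w; rewrite indicE; case: (_ \in _); rewrite ?normr1 ?normr0.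
Qed.

Lemma bounded_mfun_max0 f :
  bounded_mfun f -> bounded_mfun (fun w => Num.max (f w) 0).
Proof.
move=> [mf [M fM]]; split.
  by apply: measurable_maxr => //; exact: measurable_cst.
exists M => w; apply: le_trans (fM w).
by case: (leP (f w) 0) => _; rewrite ?normr0.
Qed.

Lemma Rintegral_cst1 (c : R) : Rintegral P setT (fun=> c) = c.
Proof.
by rewrite (Rintegral_cst P) //= probability_setT mulr1.
Qed.

Lemma Rintegral_indic A : measurable A -> Rintegral P setT (\1_A) = fine (P A).
Proof. by move=> mA; rewrite /Rintegral integral_indic // setIT. Qed.

(** The integral of a nonnegative function is a supremum over the simple functions below it, and
    this family grows with the function. *)
Lemma ge0_le_integral_nomeas p q : (forall w, 0 <= p w) ->
  (forall w, p w <= q w) ->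
  (\int[P]_w (p w)%:E <= \int[P]_w (q w)%:E)%E.
Proof.
move=> p0 pq; rewrite !ge0_integralTE; last 2 first.
- by move=> w; rewrite lee_fin (le_trans (p0 w)).
- by move=> w; rewrite lee_fin.
apply: ereal_sup_le => _ [h /= hp <-]; exists h => //= w.
by rewrite (le_trans (hp w)) // lee_fin.
Qed.

Lemma EFin_Rintegral f : bounded_mfun f ->
  (\int[P]_w (f w)%:E)%E = (Rintegral P setT f)%:E.
Proof.
move=> bf; rewrite /Rintegral fineK //.
exact: (integrable_fin_num measurableT (bounded_mfun_integrable bf)).
Qed.

Lemma le_Rintegral_bounded f g : bounded_mfun f -> bounded_mfun g ->
  (forall w, f w <= g w) -> Rintegral P setT f <= Rintegral P setT g.
Proof.
by move=> bf bg fg; apply: le_Rintegral => //; exact: bounded_mfun_integrable.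
Qed.

Lemma RintegralD_bounded f g : bounded_mfun f -> bounded_mfun g ->
  Rintegral P setT (fun w => f w + g w) =
  Rintegral P setT f + Rintegral P setT g.
Proof.
by move=> bf bg; apply: RintegralD => //; exact: bounded_mfun_integrable.
Qed.

Lemma RintegralB_bounded f g : bounded_mfun f -> bounded_mfun g ->
  Rintegral P setT (fun w => f w - g w) =
  Rintegral P setT f - Rintegral P setT g.
Proof.
by move=> bf bg; apply: RintegralB => //; exact: bounded_mfun_integrable.
Qed.

Lemma RintegralZ_bounded (c : R) f : bounded_mfun f ->
  Rintegral P setT (fun w => c * f w) = c * Rintegral P setT f.
Proof.
by move=> bf; apply: RintegralZl => //; exact: bounded_mfun_integrable.
Qed.

(** The arbitrary [p] is squeezed between two measurable functions, [q + e] and [q - e] truncated at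
    0; the truncation keeps the lower one among the nonnegative functions. Finiteness of the
    integral of [p] comes out of the squeeze, hence the existential [I]. *)
Lemma ge0_integral_dist p q e : (forall w, 0 <= p w) -> (forall w, 0 <= q w) ->
  bounded_mfun q -> bounded_mfun e -> (forall w, `|p w - q w| <= e w) ->
  exists I : R, (\int[P]_w (p w)%:E)%E = I%:E /\
    `|I - Rintegral P setT q| <= Rintegral P setT e.
Proof.
move=> p0 q0 bq be pqe.
have up : (\int[P]_w (p w)%:E <= (Rintegral P setT q + Rintegral P setT e)%:E)%E.
  rewrite -RintegralD_bounded // -EFin_Rintegral; last exact: bounded_mfunD.
  apply: ge0_le_integral_nomeas => // w.
  by have := pqe w; rewrite ler_norml => /andP[_]; lra.
have lo : ((Rintegral P setT q - Rintegral P setT e)%:E <= \int[P]_w (p w)%:E)%E.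
  rewrite -RintegralB_bounded //.
  have bm := bounded_mfun_max0 (bounded_mfunB bq be).
  apply: (@le_trans _ _ (Rintegral P setT (fun w => Num.max (q w - e w) 0))%:E).
    rewrite lee_fin; apply: le_Rintegral_bounded => //.
      exact: bounded_mfunB.
    by move=> w; rewrite le_max lexx.
  rewrite -EFin_Rintegral //; apply: ge0_le_integral_nomeas => w.
    by rewrite le_max lexx orbT.
  rewrite ge_max p0 andbT.
  by have := pqe w; rewrite ler_norml => /andP[]; lra.
case: (\int[P]_w (p w)%:E)%E up lo => [I| |] //=; rewrite !lee_fin => up lo.
by exists I; split=> //; rewrite ler_norml; apply/andP; split; lra.
Qed.

(* [g] is arbitrary: [Rintegral] is built from lower integrals of the positive
   and negative parts, each of which moves by at most the integral of [e]. *)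
Lemma Rintegral_dist_nomeas g h e : bounded_mfun h -> bounded_mfun e ->
  (forall w, `|g w - h w| <= e w) ->
  `|Rintegral P setT g - Rintegral P setT h| <= 2 * Rintegral P setT e.
Proof.
move=> bh be ghe.
have bnh : bounded_mfun (fun w => - h w).
  by have := bounded_mfunZ (-1) bh; under eq_fun do rewrite mulN1r.
have max_dist (x y : R) : `|Num.max x 0 - Num.max y 0| <= `|x - y|.
  have := ler_norm (x - y); have := ler_norm (- (x - y)); rewrite normrN.
  by case: (leP x 0) => ?; case: (leP y 0) => ? ? ?;
    rewrite ?subrr ?normr0 // ler_norml; apply/andP; split; lra.
have [|||||I [gI hI]] := @ge0_integral_dist (fun w => Num.max (g w) 0)
    (fun w => Num.max (h w) 0) e.
- by move=> w; rewrite le_max lexx orbT.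
- by move=> w; rewrite le_max lexx orbT.
- exact: bounded_mfun_max0.
- by [].
- by move=> w; apply: le_trans (ghe w).
have [|||||J [gJ hJ]] := @ge0_integral_dist (fun w => Num.max (- g w) 0)
    (fun w => Num.max (- h w) 0) e.
- by move=> w; rewrite le_max lexx orbT.
- by move=> w; rewrite le_max lexx orbT.
- exact: bounded_mfun_max0.
- by [].
- by move=> w; apply: (le_trans (max_dist _ _)); rewrite -opprD normrN.
have -> : Rintegral P setT g = I - J.
  rewrite {1}/Rintegral integralE.
  have -> : (\int[P]_w (fun w => (g w)%:E)^\+ w)%E = I%:E.
    by rewrite -gI; apply: eq_integral => w _; rewrite funeposE EFin_max.
  have -> : (\int[P]_w (fun w => (g w)%:E)^\- w)%E = J%:E.
    by rewrite -gJ; apply: eq_integral => w _; rewrite funenegE EFin_max.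
  by [].
have -> : Rintegral P setT h = Rintegral P setT (fun w => Num.max (h w) 0)
    - Rintegral P setT (fun w => Num.max (- h w) 0).
  rewrite -RintegralB_bounded; [|exact: bounded_mfun_max0..].
  apply: eq_Rintegral => w _.
  by case: (leP (h w) 0) => ?; case: (leP (- h w) 0) => ?; lra.
rewrite !ler_norml in hI hJ *.
by move: hI hJ => /andP[? ?] /andP[? ?]; apply/andP; split; lra.
Qed.

(** Multiplying by the indicator of the complement of [N] turns the limit into an everywhere
    pointwise limit of measurable functions, to which dominated convergence applies. The change
    costs at most twice the integral of [B * \1_N], that is 0, even for a nonmeasurable [h]. *)
Lemma cvg_Rintegral_bounded (hk : nat -> T -> R) h (B : R) N :
  (forall k, measurable_fun setT (hk k)) ->
  (forall k w, `|hk k w| <= B) -> (forall w, `|h w| <= B) ->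
  measurable N -> P N = 0%E ->
  (forall w, ~ N w -> hk ^~ w @ \oo --> h w) ->
  (fun k => Rintegral P setT (hk k)) @ \oo --> Rintegral P setT h.
Proof.
move=> mhk hkB hB mN N0 hkh.
have B0 : 0 <= B.
  by apply: le_trans (hB point).
pose h' := fun w => h w * \1_(~` N) w; pose hk' k := fun w => hk k w * \1_(~` N) w.
have mhk' k : measurable_fun setT (hk' k).
  by apply: measurable_funM => //; apply: measurable_indic; exact: measurableC.
have cvg' w : hk' ^~ w @ \oo --> h' w.
  rewrite /h' /hk' indicE; have [Nw|Nw] := pselect (N w).
    rewrite memNset ?mulr0; last exact.
    under eq_cvg do rewrite mulr0; exact: cvg_cst.
  rewrite mem_set // mulr1; under eq_cvg do rewrite mulr1; exact: hkh.
have null_change g : (forall w, `|g w| <= B) -> bounded_mfun (fun w => g w * \1_(~` N) w) ->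
    Rintegral P setT g = Rintegral P setT (fun w => g w * \1_(~` N) w).
  move=> gB bg; apply/eqP; rewrite -subr_eq0 -normr_le0.
  have bN := bounded_mfunZ B (bounded_mfun_indic mN).
  apply: (le_trans (Rintegral_dist_nomeas bg bN _)).
    move=> w; rewrite !indicE in_setC; case: (w \in N) => /=.
      by rewrite mulr0 subr0 mulr1.
    by rewrite !mulr1 subrr normr0 mulr0.
  rewrite RintegralZ_bounded; last exact: bounded_mfun_indic.
  by rewrite Rintegral_indic // N0 /= !mulr0.
have bnd' g w : (forall w, `|g w| <= B) -> `|g w * \1_(~` N) w| <= B.
  move=> gB; rewrite normrM indicE; case: (_ \in _); rewrite ?normr1 ?normr0 ?mulr1 ?mulr0 //.
have mh' : measurable_fun setT h'.
  by apply: (measurable_fun_cvg (h := hk')) => // w _; exact: cvg'.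
have bh' : bounded_mfun h' by split=> //; exists B => w; exact: bnd'.
have bhk' k : bounded_mfun (hk' k) by split=> //; exists B => w; exact: bnd'.
rewrite (null_change h hB bh').
rewrite (_ : (fun k => Rintegral P setT (hk k)) =
    (fun k => Rintegral P setT (hk' k))); last first.
  by apply/funext => k; exact: (null_change (hk k) (hkB k) (bhk' k)).
have [|||||_ _] // := @dominated_convergence _ _ _ P setT measurableT
  (fun k w => (hk' k w)%:E) (fun w => (h' w)%:E) (fun=> B%:E).
- by move=> k; exact/measurable_EFinP.
- exact/measurable_EFinP.
- by apply: aeW => w _; apply: cvg_EFin; [exact: nearW | exact: cvg'].
- exact: bounded_mfun_integrable (bounded_mfun_cst B).
- by apply: aeW => w k _; rewrite /= lee_fin; exact: bnd'.
rewrite (EFin_Rintegral bh') => c.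
by apply: (fine_cvg c).
Qed.

End BoundedIntegrals.

(** * Weak convergence through discrete approximations *)

Lemma near_forall_ltn (Q : nat -> nat -> Prop) (M : nat) :
  (forall m, \forall k \near \oo, Q m k) ->
  \forall k \near \oo, forall m, (m < M)%N -> Q m k.
Proof.
move=> hQ; elim: M => [|M IH]; first exact: nearW.
near=> k => m; rewrite ltnS leq_eqVlt => /orP[/eqP ->|mM].
  by near: k; exact: hQ.
by move: m mM; near: k; exact: IH.
Unshelve. all: by end_near. Qed.

Section WeakLimit.
Context (d : measure_display) (T : measurableType d) (R : realType).
Context (P : probability T R).

(** If every [M] failed, counterexamples [y M] would converge to [x] in each coordinate, against
    continuity. A single [M] serves both as number of coordinates and as precision, which leaves one
    parameter to send to infinity. *)
Lemma continuous_cylinder (f : {ptws nat -> R} -> R) (x : nat -> R) (e : R) :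
  continuous f -> 0 < e ->
  exists M : nat, forall y : nat -> R,
    (forall m, (m < M)%N -> `|y m - x m| <= M.+1%:R^-1) -> `|f y - f x| <= e.
Proof.
move=> cf e0; apply: contrapT => /forallNP H.
have /choice[y hy] M : exists y : nat -> R,
    (forall m, (m < M)%N -> `|y m - x m| <= M.+1%:R^-1) /\ ~ `|f y - f x| <= e.
  by have /existsNP[y /not_implyP[? ?]] := H M; exists y.
have yx : {ptws, y @ \oo --> x}.
  apply/pointwise_cvgP => m; suff: (fun M => y M m) @ \oo --> x m by [].
  apply/cvgrPdist_le => eps eps0; near=> M; rewrite /= distrC; have mM : (m < M)%N.
    by near: M; exact: nbhs_infty_gt.
  apply: le_trans ((hy M).1 m mM) _; apply/ltW.
  by near: M; exact: (near_infty_natSinv_lt (PosNum eps0)).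
have /cvgrPdist_le/(_ e e0) : (f \o y) M @[M --> \oo] --> f x.
  exact: (@cvg_comp _ _ _ y f _ _ _ yx (cf x)).
case=> M _ /(_ M (leqnn M)) /=; rewrite distrC; exact: (hy M).2.
Unshelve. all: by end_near. Qed.

(* A version of Billingsley's "second converging together" theorem in which
   the approximations are discrete, so that no tightness is needed. *)
Lemma cvg_Rintegral_approx (f : {ptws nat -> R} -> R) (B : R)
  (X : T -> nat -> R) (Xn : nat -> T -> nat -> R)
  (Y : nat -> T -> nat -> R) (Yn : nat -> nat -> T -> nat -> R) (N : set T) :
  continuous f -> (forall x, `|f x| <= B) ->
  (forall k (g : (nat -> R) -> R), measurable_fun setT (g \o Y k)) ->
  (forall k, \forall n \near \oo,
     forall g : (nat -> R) -> R, measurable_fun setT (g \o Yn k n)) ->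
  (forall k (g : (nat -> R) -> R),
     (fun n => Rintegral P setT (g \o Yn k n)) @ \oo
       --> Rintegral P setT (g \o Y k)) ->
  measurable N -> P N = 0%E ->
  (forall w, ~ N w -> forall m, (fun k => Y k w m) @ \oo --> X w m) ->
  (forall (M : nat) (del eps : R), 0 < del -> 0 < eps ->
     \forall k \near \oo, \forall n \near \oo, exists A : set T,
       [/\ measurable A, (P A <= eps%:E)%E &
         forall w, ~ A w -> forall m, (m < M)%N ->
           `|Xn n w m - Yn k n w m| <= del]) ->
  (fun n => Rintegral P setT (fun w => f (Xn n w))) @ \oo
    --> Rintegral P setT (fun w => f (X w)).
Proof.
move=> cf fB mY mYn cvgY mN N0 YX close.
have B0 : 0 <= B by apply: le_trans (fB point).
apply/cvgrPdist_le => e e0.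
(* The final count is [e1] for replacing [X] by [Y], [e1] for passing from [Y] to [Yn], and
   [2 * (e1 + 2 * B * (3 * e1))] for passing from [Yn] to [Xn]: in all [(12 * B + 4) * e1]. *)
pose e1 := e / (12 * B + 5).
have e10 : 0 < e1 by rewrite divr_gt0 //; lra.
have ee1 : e1 * (12 * B + 5) = e by rewrite /e1 divfK // gt_eqF //; lra.
pose good M (x : nat -> R) := forall y : nat -> R,
  (forall m, (m < M)%N -> `|y m - x m| <= M.+1%:R^-1) -> `|f y - f x| <= e1.
(* The indicator of the points where scale [M] does not control [f]. It is only evaluated along the
   discrete [Y] and [Yn], whose laws converge for every test function. *)
pose bad M (x : nat -> R) : R := if pselect (good M x) then 0 else 1.
have bad01 M x : 0 <= bad M x <= 1.
  by rewrite /bad; case: pselect => ? /=; rewrite lexx ler01.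
have Minv M : 0 < M.+1%:R^-1 :> R by rewrite invr_gt0.
(* The level is chosen after [M], so that the approximation error matches the scale of [good M];
   [M <= k] makes the levels tend to infinity, so that [Y (kM M)] still converges to [X]. *)
have /choice[kM hkM] M : exists k, (M <= k)%N /\
    \forall n \near \oo, exists A : set T,
       [/\ measurable A, (P A <= e1%:E)%E &
         forall w, ~ A w -> forall m, (m < M)%N ->
           `|Xn n w m - Yn k n w m| <= M.+1%:R^-1].
  have [K _ hK] := close M M.+1%:R^-1 e1 (Minv M) e10.
  by exists (maxn M K); split; [exact: leq_maxl | apply: hK; exact: leq_maxr].
have kMoo : kM M @[M --> \oo] --> \oo.
  apply/cvgnyPge => K; near=> M; apply: (leq_trans _ (hkM M).1).
  by near: M; exact: nbhs_infty_ge.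
have YMX w : ~ N w -> forall m, (fun M => Y (kM M) w m) @ \oo --> X w m.
  by move=> Nw m; exact: (@cvg_comp _ _ _ kM (fun k => Y k w m) _ _ _ kMoo (YX w Nw m)).
have cvgf : (fun M => Rintegral P setT (f \o Y (kM M))) @ \oo
    --> Rintegral P setT (fun w => f (X w)).
  apply: (@cvg_Rintegral_bounded _ _ _ P (fun M => f \o Y (kM M)) _ B N) => //.
  - by move=> k w; exact: fB.
  - move=> w Nw.
    have YMXw : {ptws, (fun M => Y (kM M) w) @ \oo --> X w}.
      by apply/pointwise_cvgP => m; exact: YMX.
    exact: (@cvg_comp _ _ _ (fun M => Y (kM M) w) f _ _ _ YMXw (cf (X w))).
have cvgbad : (fun M => Rintegral P setT (bad M \o Y (kM M))) @ \oo --> (0 : R).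
  rewrite -[X in _ --> X](Rintegral_cst1 P 0).
  apply: (@cvg_Rintegral_bounded _ _ _ P (fun M => bad M \o Y (kM M)) _ 1 N) => //.
  - by move=> k w; have /andP[? ?] := bad01 k (Y (kM k) w); rewrite ger0_norm.
  - by move=> w; rewrite normr0.
  - move=> w Nw; apply: cvg_near_cst.
    (* Once [Y (kM M) w] is within half the scale [M0] of [X w], and scale [M] is itself below that
       half, the whole [M]-neighbourhood of [Y (kM M) w] lies in the [M0]-neighbourhood of [X w].
       Two oscillations of [e1 / 2] then make the point good. *)
    have [M0 hM0] := continuous_cylinder (X w) cf (divr_gt0 e10 (ltr0Sn _ 1)).
    have M00 : 0 < (M0.+1%:R)^-1 / 2 :> R by rewrite divr_gt0 // invr_gt0.
    have nearX : \forall M \near \oo, forall m, (m < M0)%N ->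
        `|X w m - Y (kM M) w m| <= (M0.+1%:R)^-1 / 2.
      apply: near_forall_ltn => m.
      by have /cvgrPdist_le/(_ _ M00) := YMX w Nw m.
    near=> M.
    have hX : forall m, (m < M0)%N -> `|X w m - Y (kM M) w m| <= (M0.+1%:R)^-1 / 2.
      by near: M.
    have MM0 : (M0 <= M)%N by near: M; exact: nbhs_infty_ge.
    have hM : M.+1%:R^-1 <= (M0.+1%:R)^-1 / 2 :> R.
      by apply/ltW; near: M; exact: (near_infty_natSinv_lt (PosNum M00)).
    rewrite /bad /=; case: pselect => //= -[] y hy.
    have h1 : `|f y - f (X w)| <= e1 / 2.
      apply: hM0 => m mM0; rewrite [leRHS]splitr.
      apply: (le_trans (ler_distD (Y (kM M) w m) _ _)); apply: lerD.
        exact: le_trans (hy m (leq_trans mM0 MM0)) hM.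
      by rewrite distrC; exact: hX.
    have h2 : `|f (Y (kM M) w) - f (X w)| <= e1 / 2.
      apply: hM0 => m mM0; rewrite distrC (le_trans (hX m mM0)) //.
      by rewrite [leRHS]splitr lerDl ltW.
    rewrite [leRHS]splitr; apply: (le_trans (ler_distD (f (X w)) _ _)).
    by apply: lerD => //; rewrite distrC.
have [M [hf hb]] : exists M,
   `|Rintegral P setT (fun w => f (X w)) - Rintegral P setT (f \o Y (kM M))| <= e1 /\
   Rintegral P setT (bad M \o Y (kM M)) <= e1.
  move/cvgrPdist_le/(_ e1 e10): cvgf => [M1 _ h1].
  move/cvgrPdist_le/(_ e1 e10): cvgbad => [M2 _ h2].
  exists (maxn M1 M2); split; first by apply: h1; exact: leq_maxl.
  by have := h2 (maxn M1 M2) (leq_maxr _ _); rewrite /= sub0r normrN => /ler_normlW.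
have := cvgY (kM M) f; move/cvgrPdist_le => /(_ e1 e10) cf1.
have := cvgY (kM M) (bad M); move/cvgrPdist_le => /(_ e1 e10) cb1.
near=> n.
have c1 : `|Rintegral P setT (f \o Y (kM M)) - Rintegral P setT (f \o Yn (kM M) n)| <= e1.
  by near: n.
have c2 : `|Rintegral P setT (bad M \o Y (kM M)) -
            Rintegral P setT (bad M \o Yn (kM M) n)| <= e1.
  by near: n.
have mn : forall g : (nat -> R) -> R, measurable_fun setT (g \o Yn (kM M) n).
  by near: n; exact: mYn.
have [A [mA PA hA]] : exists A : set T,
       [/\ measurable A, (P A <= e1%:E)%E &
         forall w, ~ A w -> forall m, (m < M)%N ->
           `|Xn n w m - Yn (kM M) n w m| <= M.+1%:R^-1].
  by near: n; exact: (hkM M).2.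
have bb : bounded_mfun (bad M \o Yn (kM M) n).
  split; first exact: mn.
  by exists 1 => w /=; have /andP[? ?] := bad01 M (Yn (kM M) n w); rewrite ger0_norm.
have bf : bounded_mfun (f \o Yn (kM M) n).
  by split; [exact: mn | exists B => w; exact: fB].
have bA := bounded_mfun_indic R mA.
have bc := bounded_mfun_cst T e1.
have bs := bounded_mfunZ (2 * B) (bounded_mfunD bb bA).
(* The pointwise error is [e1] when [Yn] is good and [w] lies outside [A], and the trivial [2 * B]
   otherwise. *)
have := Rintegral_dist_nomeas P (g := fun w => f (Xn n w)) bf (bounded_mfunD bc bs).
rewrite (RintegralD_bounded P bc bs) Rintegral_cst1.
rewrite (RintegralZ_bounded P _ (bounded_mfunD bb bA)) (RintegralD_bounded P bb bA).
rewrite (Rintegral_indic P mA).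
have PA' : fine (P A) <= e1 by rewrite -lee_fin fineK // fin_num_measure.
have PA0 : 0 <= fine (P A) by exact: fine_ge0.
have b0 : 0 <= Rintegral P setT (bad M \o Yn (kM M) n).
  by apply: (Rintegral_ge0 P) => w _; have /andP[] := bad01 M (Yn (kM M) n w).
have b1 : Rintegral P setT (bad M \o Yn (kM M) n) <= 2 * e1.
  by move: c2; rewrite ler_norml => /andP[? ?]; lra.
have prod_le : (2 * B) * (Rintegral P setT (bad M \o Yn (kM M) n) + fine (P A)) <=
    (2 * B) * (3 * e1).
  by apply: ler_wpM2l; lra.
move=> hd; have {hd} : `|Rintegral P setT (fun w => f (Xn n w)) -
    Rintegral P setT (f \o Yn (kM M) n)| <= 2 * (e1 + (2 * B) * (3 * e1)).
  apply: le_trans (hd _) _; last by lra.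
  move=> w; have f1 := fB (Xn n w); have f2 := fB (Yn (kM M) n w).
  have f3 := ler_normB (f (Xn n w)) (f (Yn (kM M) n w)).
  rewrite indicE; have [Aw|Aw] := pselect (A w); [rewrite mem_set //|rewrite memNset //].
    have /andP[x0 _] := bad01 M (Yn (kM M) n w).
    have : 2 * B * 1 <= 2 * B * (bad M (Yn (kM M) n w) + 1) by apply: ler_wpM2l; lra.
    rewrite /=; lra.
  rewrite /= /bad; case: pselect => [gd|?] /=; last by lra.
  rewrite addr0 mulr0 addr0; apply: gd => m mM; exact: hA.
have -> : e = e1 * (12 * B + 5) by [].
have t1 := ler_distD (Rintegral P setT (f \o Y (kM M)))
  (Rintegral P setT (fun w => f (X w))) (Rintegral P setT (f \o Yn (kM M) n)).
have := ler_distD (Rintegral P setT (f \o Yn (kM M) n))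
  (Rintegral P setT (fun w => f (X w))) (Rintegral P setT (fun w => f (Xn n w))).
rewrite (distrC (Rintegral P setT (f \o Yn _ _))) => t2 t3.
move: hf c1 t1 t2 t3; rewrite mulrDr; lra.
Unshelve. all: by end_near. Qed.

End WeakLimit.

(** * Rounding and divisibility averages *)

Section Cells.
Context (R : realType).
Implicit Types (x : R) (k b a : nat).

(* For [x] in []0, 1]] this is the [a] with [a / k.+1 < x <= a.+1 / k.+1]; the
   half-open side matches both the distribution function of the uniform law and
   the count of integers [i] with [i / n <= b / k.+1]. *)
Definition cell k x : nat :=
  find (fun a => x <= a.+1%:R / k.+1%:R) (iota 0 k).

Lemma cell_le k x : (cell k x <= k)%N.
Proof. by rewrite -[leqRHS](size_iota 0 k) find_size. Qed.

(** Events [cell < b] are half-lines, the form in which both laws are known. The extreme thresholds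
    are exceptional: [find] returns [k] when its search fails, so the last cell absorbs [x > 1], and
    the first one absorbs [x <= 0]. *)
Lemma cell_lt k b x : (b <= k.+1)%N ->
  (cell k x < b)%N = (b == k.+1) || ((0 < b)%N && (x <= b%:R / k.+1%:R)).
Proof.
rewrite leq_eqVlt => /orP[/eqP -> |bk]; first by rewrite eqxx ltnS cell_le.
rewrite (ltn_eqF bk) /=; rewrite ltnS in bk.
set p := (fun a => x <= a.+1%:R / k.+1%:R).
have -> : (cell k x < b)%N = has p (iota 0 b).
  by rewrite -has_take_leq ?size_iota // take_iota (minn_idPl bk).
case: b bk => [|b] bk //; rewrite ltn0Sn andTb; apply/idP/idP => [/hasP[a]|xb]; last first.
  by apply/hasP; exists b => //; rewrite mem_iota /= add0n leqnn.
rewrite mem_iota /= add0n ltnS => ab; rewrite /p => /le_trans; apply.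
by rewrite ler_pM2r ?invr_gt0 // ler_nat ltnS.
Qed.

Lemma cell_eq k a x : (cell k x == a)%:R =
  (cell k x < a.+1)%N%:R - (cell k x < a)%N%:R :> R.
Proof. by rewrite ltnS leq_eqVlt; case: ltngtP => //= _; rewrite ?subrr ?subr0. Qed.

Lemma cell_approx k x : 0 < x <= 1 ->
  x <= (cell k x).+1%:R / k.+1%:R <= x + k.+1%:R^-1.
Proof.
move=> /andP[x0 x1]; apply/andP; split.
  have := ltnSn (cell k x); rewrite cell_lt; last by rewrite ltnS cell_le.
  by case/orP => [/eqP -> |//]; rewrite divff // pnatr_eq0.
rewrite -addn1 natrD mulrDl div1r lerD2r.
have := ltnn (cell k x); rewrite cell_lt; last by rewrite (leq_trans (cell_le _ _)).
move/negbT; rewrite negb_or => /andP[_]; rewrite negb_and -leqNgt leqn0 -ltNge.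
by case/orP => [/eqP ->|/ltW //]; rewrite mul0r ltW.
Qed.

(** With [c] the rounded value, [ln c - ln x = ln (1 + (c - x) / x)] is at most [(c - x) / x], where
    [c - x] is at most the mesh and [x] exceeds [eta]. *)
Lemma ln_cell_dist k x (eta : R) : 0 < eta -> eta < x <= 1 ->
  `|ln x - ln ((cell k x).+1%:R / k.+1%:R)| <= (eta * k.+1%:R)^-1.
Proof.
move=> eta0 /andP[etax x1]; have x0 : 0 < x by apply: lt_trans etax.
have /andP[lo up] : x <= (cell k x).+1%:R / k.+1%:R <= x + k.+1%:R^-1.
  by apply: cell_approx; rewrite x0.
set c := _ / _ in lo up *; have c0 : 0 < c by apply: lt_le_trans lo.
rewrite distrC ger0_norm; last by rewrite subr_ge0 ler_ln.
rewrite -ln_div //; have -> : c / x = 1 + (c - x) / x by rewrite mulrBl divff ?gt_eqF //; lra.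
apply: le_trans (le_ln1Dx _) _.
  by rewrite (lt_le_trans (ltrN10 _)) // divr_ge0 ?subr_ge0 // ltW.
rewrite invfM mulrC; apply: ler_pM.
- by rewrite invr_ge0 ltW.
- by rewrite subr_ge0.
- by rewrite lef_pV2 ?posrE // ltW.
- by rewrite lerBlDl.
Qed.

Lemma cell_ln_cvg x : 0 < x <= 1 ->
  (fun k => ln ((cell k x).+1%:R / k.+1%:R)) @ \oo --> ln x.
Proof.
move=> /andP[x0 x1]; apply: continuous_cvg; first exact: continuous_ln.
apply/cvgrPdist_le => /= e e0; near=> k.
have /andP[lo up] : x <= (cell k x).+1%:R / k.+1%:R <= x + k.+1%:R^-1.
  by apply: cell_approx; rewrite x0.
have ke : k.+1%:R^-1 < e by near: k; exact: (near_infty_natSinv_lt (PosNum e0)).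
by rewrite distrC ger0_norm ?subr_ge0 // lerBlDl (le_trans up) // lerD2l ltW.
Unshelve. all: by end_near. Qed.

End Cells.

Section Averages.
Context (R : realType).

Lemma near_infty_invn_lt (e : R) : 0 < e -> \forall n \near \oo, n%:R^-1 < e.
Proof.
move=> e0; have [K _ hK] := near_infty_natSinv_lt (PosNum e0).
by exists K.+1 => // -[//|n] /= Kn; exact: hK.
Qed.

Definition avg (n : nat) (F : nat -> R) : R :=
  (\sum_(1 <= i < n.+1) F i) / n%:R.

Lemma cell_ratio_lt k b n i : (b <= k.+1)%N -> (1 <= i <= n)%N ->
  (cell k (i%:R / n%:R : R) < b)%N = (i <= b * n %/ k.+1)%N.
Proof.
move=> bk /andP[i1 ilen]; have n0 : (0 < n)%N by apply: leq_trans ilen.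
rewrite cell_lt // leq_divRL //.
rewrite ler_pdivrMr ?ltr0n // mulrAC ler_pdivlMr ?ltr0n // -!natrM ler_nat.
have [->|bK] /= := eqVneq b k.+1; first by rewrite mulnC leq_mul2l ilen orbT.
by case: b bk bK => [|b] //= _ _; rewrite mul0n leqn0 muln_eq0 (gtn_eqF i1).
Qed.

Lemma sum_cell_dvd k b d n : (b <= k.+1)%N -> (0 < n)%N ->
  (\sum_(1 <= i < n.+1)
     (cell k (i%:R / n%:R : R) < b)%N * (d %| i) = b * n %/ k.+1 %/ d)%N.
Proof.
move=> bk n0; set M := (b * n %/ k.+1)%N.
have Mn : (M <= n)%N.
  by rewrite -ltnS ltn_divLR // (leq_ltn_trans (leq_mul bk (leqnn n))) // mulnC ltn_pmul2r.
rewrite (big_cat_nat (n := M.+1)) //= [X in (_ + X)%N]big1_seq ?addn0; last first.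
  move=> i; rewrite andTb mem_index_iota => /andP[Mi iN].
  by rewrite cell_ratio_lt // ?(leq_trans _ Mi) //= ?iN // leqNgt Mi.
rewrite divn_count_dvd big_nat [RHS]big_nat; apply: eq_bigr => i /andP[i1 iM].
rewrite ltnS in iM.
by rewrite cell_ratio_lt // -/M ?iM ?mul1n // i1 (leq_trans iM Mn).
Qed.

(** The two nested floors in the count merge into one with divisor [k.+1 * d]; dropping it costs
    less than [1 / n] after averaging. *)
Lemma avg_cell_dvd_cvg k b d : (b <= k.+1)%N -> (0 < d)%N ->
  (fun n => avg n (fun i => (cell k (i%:R / n%:R : R) < b)%N%:R * (d %| i)%:R))
    @ \oo --> (b%:R / k.+1%:R / d%:R : R).
Proof.
move=> bk d0; apply/cvgrPdist_le => /= e e0; near=> n.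
have n0 : (0 < n)%N by near: n; exact: nbhs_infty_gt.
have ne : n%:R^-1 <= e.
  by apply/ltW; near: n; exact: (near_infty_invn_lt e0).
have -> : avg n (fun i => (cell k (i%:R / n%:R : R) < b)%N%:R * (d %| i)%:R) =
    (b * n %/ (k.+1 * d))%N%:R / n%:R.
  rewrite /avg; congr (_ / _); rewrite divnMA -(sum_cell_dvd d bk n0) natr_sum.
  by apply: eq_bigr => i _; rewrite natrM.
set D := (k.+1 * d)%N; have D0 : (0 < D)%N by rewrite muln_gt0.
have := divn_eq (b * n) D; have := ltn_pmod (b * n) D0.
move: (b * n %% D)%N (b * n %/ D)%N => r q rD bnE.
have -> : b%:R / k.+1%:R / d%:R = (q%:R + r%:R / D%:R) / n%:R :> R.
  rewrite -mulrA -invfM -natrM -/D; apply/eqP.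
  rewrite eqr_div ?pnatr_eq0 -?lt0n // mulrDl -natrM.
  by rewrite divfK ?pnatr_eq0 -?lt0n // -natrM -natrD -bnE.
rewrite -mulrBl addrAC subrr add0r ger0_norm ?mulr_ge0 ?invr_ge0 ?ler0n //.
rewrite (le_trans _ ne) // ler_piMl ?invr_ge0 //.
by rewrite ler_pdivrMr ?ltr0n // mul1r ler_nat ltnW.
Unshelve. all: by end_near. Qed.

(* [P(min(G, k) = e)] for a geometric variable with [P(G >= j) = p^-j]. *)
Definition capped_geom (k p e : nat) : R :=
  if prime p then p%:R^-1 ^+ e - (e < k)%N%:R * p%:R^-1 ^+ e.+1 else (e == 0)%:R.

Lemma capped_eq k l e : (e <= k)%N ->
  (minn l k == e)%:R = (e <= l)%N%:R - (e < k)%N%:R * (e < l)%N%:R :> R.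
Proof.
move=> ek; rewrite /minn.
by case: (ltngtP l k) => lk; case: (ltngtP e l) => el; case: (ltngtP e k) => ek' /=;
  rewrite ?mulr1 ?mulr0 ?mul0r ?subrr ?subr0 //; lia.
Qed.

(** Induction on [ps], with [d] collecting the prime powers already treated. The indicator of a
    valuation is divisibility by [p ^ e] minus divisibility by [p ^ e.+1], the second term being
    absent at the cap [e = k]. Coprimality lets each power be absorbed into [d]. At a composite [p]
    the valuation is 0, so its factor is constant. *)
Lemma avg_valuations_cvg k b (E : nat -> nat) (ps : seq nat) d :
  (b <= k.+1)%N -> (forall p, E p <= k)%N -> uniq ps -> (0 < d)%N ->
  (forall p, p \in ps -> prime p -> coprime d p) ->
  (fun n => avg n (fun i => (cell k (i%:R / n%:R : R) < b)%N%:R * (d %| i)%:R *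
      \prod_(p <- ps) (minn (logn p i) k == E p)%:R)) @ \oo
    --> (b%:R / k.+1%:R / d%:R * \prod_(p <- ps) capped_geom k p (E p) : R).
Proof.
move=> bk Ek; elim: ps d => [|p ps IH] d /= ups d0 cop.
  rewrite big_nil mulr1; under eq_cvg do under eq_fun do rewrite big_nil mulr1.
  exact: avg_cell_dvd_cvg.
have /andP[pps {}ups] := ups; rewrite big_cons /capped_geom.
have [pp|npp] := ifP (prime p); last first.
  have -> : (fun n => avg n (fun i => (cell k (i%:R / n%:R : R) < b)%N%:R * (d %| i)%:R *
      \prod_(q <- p :: ps) (minn (logn q i) k == E q)%:R)) =
     (fun n => (E p == 0)%:R * avg n (fun i =>
      (cell k (i%:R / n%:R : R) < b)%N%:R * (d %| i)%:R *
      \prod_(q <- ps) (minn (logn q i) k == E q)%:R)).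
    apply/funext => n; rewrite /avg mulrA mulr_sumr; congr (_ / _).
    apply: eq_bigr => i _; rewrite big_cons mulrCA lognE npp min0n [0%N == _]eq_sym //.
  rewrite mulrCA; apply: cvgMl_tmp; apply: IH => // q qps; apply: cop; rewrite inE qps orbT //.
have p0 := prime_gt0 pp.
have cpd : coprime d p by apply: cop => //; rewrite mem_head.
have coppow e q : q \in ps -> prime q -> coprime (d * p ^ e) q.
  move=> qps pq; rewrite coprimeMl (cop _ _ pq) ?inE ?qps ?orbT //=.
  rewrite coprimeXl // prime_coprime // dvdn_prime2 //.
  by apply: contra pps => /eqP ->.
have dp0 e : (0 < d * p ^ e)%N by rewrite muln_gt0 d0 expn_gt0 p0.
have c1 := IH _ ups (dp0 (E p)) (coppow (E p)).
have c2 := IH _ ups (dp0 (E p).+1) (coppow (E p).+1).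
have -> : b%:R / k.+1%:R / d%:R * ((p%:R^-1 ^+ E p -
       (E p < k)%N%:R * p%:R^-1 ^+ (E p).+1) * \prod_(j <- ps) capped_geom k j (E j)) =
   b%:R / k.+1%:R / (d * p ^ E p)%:R * (\prod_(j <- ps) capped_geom k j (E j)) -
   (E p < k)%N%:R * (b%:R / k.+1%:R / (d * p ^ (E p).+1)%:R *
     (\prod_(j <- ps) capped_geom k j (E j))) :> R.
  by rewrite !natrM !natrX !invfM -!exprVn; ring.
set x := _ / (d * p ^ E p)%:R * _ in c1 *; set y := _ / (d * p ^ (E p).+1)%:R * _ in c2 *.
pose F n e i : R := (cell k (i%:R / n%:R : R) < b)%N%:R * (d * p ^ e %| i)%:R *
  \prod_(q <- ps) (minn (logn q i) k == E q)%:R.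
rewrite (_ : (fun n => avg n _) = (fun n => avg n (F n (E p)) -
    (E p < k)%N%:R * avg n (F n (E p).+1))); first exact: cvgB c1 (cvgMl_tmp c2).
apply/funext => n; rewrite /avg mulrA -mulrBl mulr_sumr -sumrB; congr (_ / _).
rewrite [LHS]big_nat [RHS]big_nat; apply: eq_bigr => i /andP[i1 _].
rewrite /F big_cons capped_eq // -!pfactor_dvdn //.
have dvdE e : (d * p ^ e %| i)%:R = (d %| i)%:R * (p ^ e %| i)%:R :> R.
  by rewrite Gauss_dvd ?coprimeXr // -mulnb natrM.
by rewrite !dvdE; ring.
Qed.

(** A cell is the difference of the thresholds [a.+1] and [a]; the induction above starts from
    [d = 1]. *)
Lemma avg_cell_valuations_cvg k a (E : nat -> nat) (ps : seq nat) :
  (a <= k)%N -> (forall p, E p <= k)%N -> uniq ps ->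
  (fun n => avg n (fun i => (cell k (i%:R / n%:R : R) == a)%:R *
      \prod_(p <- ps) (minn (logn p i) k == E p)%:R)) @ \oo
    --> (k.+1%:R^-1 * \prod_(p <- ps) capped_geom k p (E p) : R).
Proof.
move=> ak Ek ups.
have c1 := @avg_valuations_cvg k a.+1 E ps 1 ak Ek ups isT (fun _ _ _ => coprime1n _).
have c2 := @avg_valuations_cvg k a E ps 1 (leqW ak) Ek ups isT (fun _ _ _ => coprime1n _).
have -> : k.+1%:R^-1 * \prod_(p <- ps) capped_geom k p (E p) =
  a.+1%:R / k.+1%:R / 1%:R * \prod_(p <- ps) capped_geom k p (E p) -
  a%:R / k.+1%:R / 1%:R * \prod_(p <- ps) capped_geom k p (E p) :> R.
  by rewrite -[a.+1]addn1 natrD !divr1; ring.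
pose F n c i : R := (cell k (i%:R / n%:R : R) < c)%N%:R * (1 %| i)%:R *
  \prod_(q <- ps) (minn (logn q i) k == E q)%:R.
rewrite (_ : (fun n => avg n _) = (fun n => avg n (F n a.+1) - avg n (F n a)));
  first exact: cvgB c1 c2.
apply/funext => n; rewrite /avg -mulrBl -sumrB; congr (_ / _); apply: eq_bigr => i _.
by rewrite /F cell_eq dvd1n !mulr1 mulrBl.
Qed.

End Averages.

(** * The least common multiple of a sample *)

Section LcmOfSample.
Context (R : realType).
Implicit Types (u : nat -> nat) (m n k p : nat).

Lemma size_distinct_upto_le u m : (distinct_upto u m <= m)%N.
Proof. by rewrite (leq_trans (size_undup _)) // size_map size_iota. Qed.

Lemma uniq_map_iota u m : (forall i j, (i < j < m)%N -> u i != u j) ->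
  uniq [seq u i | i <- iota 0 m].
Proof.
move=> uI; rewrite map_inj_in_uniq ?iota_uniq // => i j.
rewrite !mem_iota /= !add0n => im jm uij; apply/eqP; apply: contraT => /negbTE ij.
case: (ltngtP i j) ij => // ij _.
- by have := uI i j; rewrite ij jm uij eqxx => /(_ isT).
- by have := uI j i; rewrite ij im uij eqxx => /(_ isT).
Qed.

(** Fewer than [m] draws cannot show [m] values, so [m] itself is the minimum. *)
Lemma first_time_inj u m : (forall i j, (i < j < m)%N -> u i != u j) ->
  first_time u m = m.
Proof.
move=> uI; have um : distinct_upto u m == m.
  by rewrite /distinct_upto undup_id ?uniq_map_iota // size_map size_iota.
rewrite /first_time; case: pselect => [h|[]]; last by exists m.
case: ex_minnP => c /eqP cm cmin; apply/eqP; rewrite eqn_leq cmin //=.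
by rewrite -{1}cm size_distinct_upto_le.
Qed.

Lemma lcm_seq_Bset n u m : (m < n)%N ->
  (forall i j, (i < j <= m)%N -> u i != u j) ->
  lcm_seq (Bset n u m.+1) = \big[lcmn/1%N]_(j < m.+1) u j.
Proof.
move=> mn uI; have uI' i j : (i < j < m.+1)%N -> u i != u j.
  by rewrite ltnS; exact: uI.
rewrite /lcm_seq /Bset /tau (minn_idPl mn) first_time_inj //.
rewrite undup_id ?uniq_map_iota // big_map.
by rewrite -[m.+1]subn0 -/(index_iota 0 m.+1) big_mkord subn0.
Qed.

Lemma biglcmn_gt0 u m : (forall j, (j < m)%N -> (0 < u j)%N) ->
  (0 < \big[lcmn/1%N]_(j < m) u j)%N.
Proof.
move=> u0; elim/big_ind: _ => // [x y x0 y0|j _]; last exact: u0.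
by rewrite lcmn_gt0 x0.
Qed.

Lemma logn_biglcmn p u m : (forall j, (j < m)%N -> (0 < u j)%N) ->
  logn p (\big[lcmn/1%N]_(j < m) u j) = (\max_(j < m) logn p (u j))%N.
Proof.
elim: m => [|m IH] u0; first by rewrite !big_ord0 logn1.
have u0' j : (j < m)%N -> (0 < u j)%N by move=> jm; apply: u0; exact: ltnW.
by rewrite !big_ord_recr /= logn_lcm ?biglcmn_gt0 ?u0 // IH.
Qed.

Lemma ln_prod_pow (s : seq nat) (e : nat -> nat) :
  ln ((\prod_(p <- s | prime p) p ^ e p)%N%:R : R) =
  \sum_(p <- s | prime p) (e p)%:R * ln (p%:R : R).
Proof.
elim: s => [|p s IH]; first by rewrite !big_nil ln1.
rewrite !big_cons; case: ifP => // pp.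
have p0 := prime_gt0 pp.
have prod0 : (0 < \prod_(q <- s | prime q) q ^ e q)%N.
  by rewrite prodn_cond_gt0 // => q pq; rewrite expn_gt0 prime_gt0.
rewrite natrM natrX lnM ?posrE ?exprn_gt0 ?ltr0n // IH.
by rewrite lnXn ?ltr0n // mulr_natl.
Qed.

Lemma ln_natE x N : (0 < x < N)%N ->
  ln (x%:R : R) = \sum_(0 <= p < N | prime p) (logn p x)%:R * ln (p%:R : R).
Proof.
case: N => [|N] /andP[x0]; rewrite ?ltn0 // ltnS => xN.
rewrite -ln_prod_pow; congr (ln _%:R).
rewrite -{1}(partnT x0) (widen_partn _ xN) [RHS]big_mkcond.
by apply: eq_bigr => p _; case: ifP => // npp; rewrite lognE npp.
Qed.

(** At most one entry is nonzero, and both sides equal it. Hence a prime dividing at most one draw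
    contributes nothing to the defect. *)
Lemma bigmax_sum_disjoint (l : nat -> nat) m :
  (forall i j, (i < j <= m)%N -> l i = 0%N \/ l j = 0%N) ->
  (\max_(j < m.+1) l j = \sum_(j < m.+1) l j)%N.
Proof.
move=> h; have [/forallP l0|] := boolP [forall j : 'I_m.+1, l j == 0%N].
  by rewrite big1 ?[RHS]big1 // => j _; exact/eqP.
rewrite negb_forall => /existsP[j0 lj0].
have l0 (j : 'I_m.+1) : j != j0 -> l j = 0%N.
  rewrite -val_eqE /=; case: ltngtP => // jj _.
  - by have [] := h j j0 _; rewrite ?jj -1?ltnS ?ltn_ord // => /eqP; rewrite (negbTE lj0).
  - by have [] := h j0 j _; rewrite ?jj -1?ltnS ?ltn_ord // => /eqP; rewrite (negbTE lj0).
by rewrite (bigD1 j0) //= [RHS](bigD1 j0) //= !big1 ?maxn0 ?addn0.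
Qed.

Definition lcm_defect (l : nat -> nat -> nat) m p : R :=
  ln p%:R * ((\max_(j < m.+1) l j p)%N%:R - (\sum_(j < m.+1) l j p)%N%:R).

Lemma sum_lcm_defect_stable (l : nat -> nat -> nat) m N0 N : (N0 <= N)%N ->
  (forall p i j, prime p -> (N0 <= p)%N -> (i < j <= m)%N ->
     l i p = 0%N \/ l j p = 0%N) ->
  \sum_(p < N | prime p) lcm_defect l m p =
  \sum_(p < N0 | prime p) lcm_defect l m p.
Proof.
move=> N0N h; rewrite -!(big_mkord (fun p => prime p)) (big_cat_nat (n := N0)) //=.
rewrite [X in _ + X]big_nat_cond [X in _ + X]big1 ?addr0 // => p /andP[/andP[Np _] pp].
rewrite /lcm_defect (@bigmax_sum_disjoint (fun j => l j p)) ?subrr ?mulr0 //.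
by move=> i j; exact: h.
Qed.

Lemma lcm_vector_sample n u m N0 : (m < n)%N ->
  (forall j, (j <= m)%N -> (0 < u j)%N) ->
  (forall i j, (i < j <= m)%N -> u i != u j) ->
  (forall p i j, prime p -> (N0 <= p)%N -> (i < j <= m)%N ->
     logn p (u i) = 0%N \/ logn p (u j) = 0%N) ->
  lcm_vector R n u m = \sum_(j < m.+1) ln ((u j)%:R / n%:R) +
    \sum_(p < N0 | prime p) lcm_defect (fun j p => logn p (u j)) m p.
Proof.
move=> mn u0 uI cop; rewrite /lcm_vector lcm_seq_Bset //.
set L := \big[lcmn/1%N]_(j < m.+1) u j.
have u0' j : (j < m.+1)%N -> (0 < u j)%N by rewrite ltnS; exact: u0.
have n0 : (0 < n)%N by apply: leq_ltn_trans mn.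
(* A common bound above [N0], the lcm and every draw, so that all the factorizations run over the
   same range of primes. *)
pose N := (N0 + L + \sum_(j < m.+1) u j).+1.
have LN : (0 < L < N)%N by rewrite biglcmn_gt0 //= ltnS -addnA addnCA leq_addr.
have uN (j : 'I_m.+1) : (0 < u j < N)%N.
  by rewrite u0' //= ltnS /N (bigD1 j) //= addnA addnAC addnC leq_addr.
rewrite -(@sum_lcm_defect_stable _ _ _ N) //; last by rewrite leqW // -addnA leq_addr.
have -> : \sum_(j < m.+1) ln ((u j)%:R / n%:R : R) =
    \sum_(j < m.+1) ln ((u j)%:R : R) - m.+1%:R * ln n%:R.
  rewrite (eq_bigr (fun j : 'I_m.+1 => ln ((u j)%:R : R) - ln n%:R)); last first.
    by move=> j _; rewrite ln_div // posrE ltr0n // u0'.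
  by rewrite sumrB sumr_const card_ord mulr_natl.
rewrite -addrA [- _ + _]addrC addrA; congr (_ - _).
rewrite (ln_natE LN) [\sum_(j < m.+1) _](eq_bigr _ (fun j _ => ln_natE (uN j))).
rewrite -(big_mkord (fun p => prime p)) exchange_big /= -big_split /=.
apply: eq_bigr => p _; rewrite /lcm_defect logn_biglcmn // natr_sum -mulr_suml.
ring.
Qed.

Lemma limit_vector_sample (g : nat -> nat -> nat) (v : nat -> R) m N0 :
  (forall p i j, prime p -> (N0 <= p)%N -> (i < j <= m)%N ->
     g i p = 0%N \/ g j p = 0%N) ->
  limit_vector g v m = \sum_(j < m.+1) ln (v j) +
    \sum_(p < N0 | prime p) lcm_defect g m p.
Proof.
move=> h; rewrite /limit_vector; congr (_ + _).
apply: lim_near_cst; first exact: norm_hausdorff.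
by exists N0 => // N /= N0N; exact: sum_lcm_defect_stable.
Qed.

End LcmOfSample.

(** * Finite-valued approximations of the two vectors *)

Section Discretization.
Context (R : realType).

(** For each coordinate, a cell and a table of capped valuations. The one parameter [k] governs the
    number of coordinates, the mesh, the cap and the range of primes, so only one limit in [k] has
    to be taken. *)
Definition grid k : finType :=
  {ffun 'I_k.+1 -> 'I_k.+1 * {ffun 'I_k.+1 -> 'I_k.+1}}.

(** The variables [G j p] are unconstrained at composite [p]. Setting them to 0 there agrees with
    [logn] and allows tables indexed by all [p <= k]. *)
Definition prime_part (p e : nat) : nat := if prime p then e else 0%N.

Definition discretize k (x : nat -> R) (l : nat -> nat -> nat) : grid k :=
  [ffun j : 'I_k.+1 => (inord (cell k (x j)),
     [ffun p : 'I_k.+1 => inord (minn (prime_part p (l j p)) k)])].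

(** For [m > k] the out-of-range [inord j] reads coordinate 0, so these entries are meaningless;
    each fixed [m] is eventually at most [k], which suffices for the product topology. *)
Definition grid_vector k (z : grid k) (m : nat) : R :=
  \sum_(j < m.+1) ln ((z (inord j)).1.+1%:R / k.+1%:R : R) +
  \sum_(p < k.+1 | prime p)
    lcm_defect R (fun j q => (z (inord j)).2 (inord q)) m p.

Lemma grid_vector_discretize k (x : nat -> R) (l : nat -> nat -> nat) m :
  (m <= k)%N ->
  grid_vector (discretize k x l) m =
  \sum_(j < m.+1) ln ((cell k (x j)).+1%:R / k.+1%:R : R) +
  \sum_(p < k.+1 | prime p) lcm_defect R (fun j q => minn (l j q) k) m p.
Proof.
move=> mk; have jk (j : 'I_m.+1) : (j < k.+1)%N.
  by rewrite (leq_trans (ltn_ord j)) // ltnS.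
congr (_ + _).
  apply: eq_bigr => j _; by rewrite ffunE /= !inordK ?jk // ltnS cell_le.
apply: eq_bigr => p pp; rewrite /lcm_defect.
have e (j : 'I_m.+1) : (discretize k x l (inord j)).2 (inord p) = minn (l j p) k :> nat.
  rewrite !ffunE /= (inordK (ltn_ord p)) (inordK (jk j)).
  by rewrite inordK ?ltnS ?geq_minr // /prime_part pp.
by rewrite (eq_bigr _ (fun j _ => e j)) [in X in _ - X%:R](eq_bigr _ (fun j _ => e j)).
Qed.

Lemma discretize_eqP k (x : nat -> R) (l : nat -> nat -> nat) (z : grid k) :
  discretize k x l = z <->
  (forall j, (j < k.+1)%N -> cell k (x j) = (z (inord j)).1 :> nat /\
    forall p, (p < k.+1)%N ->
      minn (prime_part p (l j p)) k = (z (inord j)).2 (inord p) :> nat).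
Proof.
split=> [<- j jk|h].
  rewrite !ffunE /= !inordK ?ltnS ?cell_le //; split=> // p pk.
  by rewrite ffunE (inordK pk) inordK ?ltnS ?geq_minr.
apply/ffunP => j; rewrite ffunE; have [hc hp] := h j (ltn_ord j).
rewrite inord_val in hc hp; rewrite [RHS]surjective_pairing; congr (_, _).
  by apply/val_inj; rewrite /= inordK ?ltnS ?cell_le.
apply/ffunP => p; rewrite ffunE; apply/val_inj; rewrite /= inordK ?ltnS ?geq_minr //.
by rewrite (hp p (ltn_ord p)) inord_val.
Qed.

(* The vectors agree exactly in their arithmetic part; only [x] is rounded. *)
Lemma grid_vector_dist k (x : nat -> R) (l : nat -> nat -> nat) m y (eta : R) :
  (m <= k)%N -> 0 < eta -> (forall j, (j <= m)%N -> eta < x j <= 1) ->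
  (forall p j, prime p -> (p <= k)%N -> (j <= m)%N -> (l j p <= k)%N) ->
  y = \sum_(j < m.+1) ln (x j) + \sum_(p < k.+1 | prime p) lcm_defect R l m p ->
  `|y - grid_vector (discretize k x l) m| <= m.+1%:R / (eta * k.+1%:R).
Proof.
move=> mk eta0 hx hl ->; rewrite grid_vector_discretize //.
have -> : \sum_(p < k.+1 | prime p) lcm_defect R (fun j q => minn (l j q) k) m p =
    \sum_(p < k.+1 | prime p) lcm_defect R l m p.
  apply: eq_bigr => p pp; rewrite /lcm_defect.
  have e (j : 'I_m.+1) : minn (l j p) k = l j p.
    by apply/minn_idPl; apply: hl; rewrite // -ltnS.
  by rewrite (eq_bigr _ (fun j _ => e j)) [in X in _ - X%:R](eq_bigr _ (fun j _ => e j)).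
rewrite opprD addrACA subrr addr0 -sumrB; apply: (le_trans (ler_norm_sum _ _ _)).
have -> : m.+1%:R / (eta * k.+1%:R) = \sum_(j < m.+1) (eta * k.+1%:R)^-1.
  by rewrite sumr_const card_ord mulr_natl.
apply: ler_sum => j _.
by apply: ln_cell_dist => //; apply: hx; rewrite -ltnS.
Qed.

End Discretization.

(** * Finite-valued random variables and union bounds *)

Section BigLimits.
Context (R : realType) (I : Type).

Lemma cvg_sum_seq (s : seq I) (F : I -> nat -> R) (l : I -> R) :
  (forall i, F i @ \oo --> l i) ->
  (fun n => \sum_(i <- s) F i n) @ \oo --> \sum_(i <- s) l i.
Proof.
by move=> Fl; apply: cvg_big => [|i _]; [exact: add_continuous | exact: Fl].
Qed.

Lemma cvg_prod_seq (s : seq I) (F : I -> nat -> R) (l : I -> R) :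
  (forall i, F i @ \oo --> l i) ->
  (fun n => \prod_(i <- s) F i n) @ \oo --> \prod_(i <- s) l i.
Proof.
by move=> Fl; apply: cvg_big => [|i _]; [exact: mul_continuous | exact: Fl].
Qed.

End BigLimits.

Section FiniteProbability.
Context (d : measure_display) (T : measurableType d) (R : realType).
Context (P : probability T R).

(** The composite is a finite combination of indicators for any [h]; this is what admits the
    discontinuous [bad] as a test function. *)
Lemma Rintegral_finite_valued (S : finType) (Z : T -> S) (h : S -> R) :
  (forall z, measurable (Z @^-1` [set z])) ->
  measurable_fun setT (h \o Z) /\
  Rintegral P setT (h \o Z) = \sum_z h z * fine (P (Z @^-1` [set z])).
Proof.
move=> mZ.
have hE : h \o Z = fun w => \sum_(z <- index_enum S) h z * \1_(Z @^-1` [set z]) w.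
  apply/funext => w /=; rewrite (bigD1 (Z w)) //= indicE mem_set // mulr1.
  rewrite big1 ?addr0 // => z zZ; rewrite indicE memNset ?mulr0 //= => Zz.
  by rewrite Zz eqxx in zZ.
have b z : bounded_mfun (fun w => h z * \1_(Z @^-1` [set z]) w : R).
  by apply: bounded_mfunZ; exact: bounded_mfun_indic.
have ind (s : seq S) : bounded_mfun (fun w => \sum_(z <- s) h z * \1_(Z @^-1` [set z]) w : R) /\
    Rintegral P setT (fun w => \sum_(z <- s) h z * \1_(Z @^-1` [set z]) w) =
    \sum_(z <- s) h z * fine (P (Z @^-1` [set z])).
  elim: s => [|z s [IHb IHi]].
    rewrite (_ : (fun w => _) = fun=> 0) ?big_nil; last by apply/funext => w; rewrite big_nil.
    by split; [exact: bounded_mfun_cst | rewrite Rintegral_cst1].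
  rewrite (_ : (fun w => _) = fun w => h z * \1_(Z @^-1` [set z]) w +
    \sum_(z <- s) h z * \1_(Z @^-1` [set z]) w); last by apply/funext => w; rewrite big_cons.
  split; first exact: bounded_mfunD.
  rewrite RintegralD_bounded // IHi big_cons RintegralZ_bounded ?Rintegral_indic //.
  exact: bounded_mfun_indic.
by rewrite hE; have [[? _] ->] := ind (index_enum S).
Qed.

Lemma cvg_Rintegral_finite_valued (S : finType) (Zn : nat -> T -> S) (Z : T -> S)
    (q : S -> R) (h : S -> R) :
  (forall z, measurable (Z @^-1` [set z])) ->
  (\forall n \near \oo, forall z, measurable (Zn n @^-1` [set z])) ->
  (forall z, P (Z @^-1` [set z]) = (q z)%:E) ->
  (forall z, (fun n => fine (P (Zn n @^-1` [set z]))) @ \oo --> q z) ->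
  (fun n => Rintegral P setT (h \o Zn n)) @ \oo --> Rintegral P setT (h \o Z).
Proof.
move=> mZ mZn qZ qZn; rewrite (Rintegral_finite_valued h mZ).2.
apply: cvg_trans.
  apply: near_eq_cvg; near=> n.
  by apply/esym; apply: (Rintegral_finite_valued h _).2; near: n.
apply: cvg_sum_seq => z; rewrite qZ; exact: cvgMl_tmp.
Unshelve. all: by end_near. Qed.

Lemma prob_diff (A B : set T) (a b : R) : measurable A -> measurable B ->
  B `<=` A -> P A = a%:E -> P B = b%:E -> P (A `\` B) = (a - b)%:E.
Proof.
move=> mA mB BA PA PB; have AB : P (A `&` B) = b%:E by rewrite setIidr.
rewrite EFinB -PA -AB; apply: measureD => //.
by apply: (le_lt_trans (probability_le1 P mA)); rewrite ltry.
Qed.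

Lemma measurable_nat_preimage (X : T -> nat) (A : set nat) :
  measurable_fun setT (fun w => (X w)%:R : R) -> measurable (X @^-1` A).
Proof.
move=> mX; have mA : measurable ([set (i%:R : R) | i in A]).
  rewrite -bigcup_imset1 ; apply: bigcup_measurable => i _; exact: measurable_set1.
have := mX measurableT _ mA; rewrite setTI; congr measurable.
apply/seteqP; split => w /=; last by exists (X w).
by case=> i Ai /eqP; rewrite eqr_nat => /eqP <-.
Qed.

Lemma natr_image_preimage (X : T -> nat) (A : set nat) :
  (fun w => (X w)%:R : R) @^-1` [set i%:R | i in A] = X @^-1` A.
Proof.
apply/seteqP; split => w /=; last by exists (X w).
by case=> i Ai /eqP; rewrite eqr_nat => /eqP <-.
Qed.

Lemma measurable_natr_image (A : set nat) : measurable ([set (i%:R : R) | i in A]).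
Proof.
by rewrite -bigcup_imset1; apply: bigcup_measurable => i _; exact: measurable_set1.
Qed.

Lemma prod_EFin (I : Type) (s : seq I) (F : I -> R) :
  (\prod_(i <- s) (F i)%:E = (\prod_(i <- s) F i)%:E)%E.
Proof. by rewrite (big_morph EFin (@EFinM R) erefl). Qed.

(** An outer-measure bound, stable under subsets and unions, so that union bounds compose without a
    measurability check for each union. *)
Definition outer_le (A : set T) (r : R) : Prop :=
  exists B, [/\ measurable B, A `<=` B & (P B <= r%:E)%E].

Lemma outer_le_measurable A r : measurable A -> (P A <= r%:E)%E -> outer_le A r.
Proof. by move=> mA PA; exists A; split. Qed.

Lemma outer_le_sub A A' r r' : A' `<=` A -> r <= r' -> outer_le A r -> outer_le A' r'.
Proof.
move=> AA rr [B [mB AB PB]]; exists B; split=> //; first exact: subset_trans AB.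
by rewrite (le_trans PB) // lee_fin.
Qed.

Lemma outer_leU A A' r r' :
  outer_le A r -> outer_le A' r' -> outer_le (A `|` A') (r + r').
Proof.
move=> [B [mB AB PB]] [B' [mB' AB' PB']]; exists (B `|` B'); split.
- exact: measurableU.
- exact: setUSS.
- by rewrite EFinD (le_trans (measureU2 _ mB mB')) // leeD.
Qed.

Lemma outer_le_exists (s : seq nat) (F : nat -> set T) (r : nat -> R) :
  (forall i, i \in s -> outer_le (F i) (r i)) ->
  outer_le [set w | exists2 i, i \in s & F i w] (\sum_(i <- s) r i).
Proof.
elim: s => [|i s IH] h.
  rewrite big_nil; exists set0; split=> //; last by rewrite measure0.
  by move=> w [].
rewrite big_cons.
have hU := outer_leU (h i (mem_head _ _)) (IH (fun j js => h j (mem_behead (s := i :: s) js))).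
apply: outer_le_sub hU => // w [j]; rewrite inE => /orP[/eqP ->|js] Fj; [by left|].
by right; exists j.
Qed.


End FiniteProbability.

(** * Uniform samples *)

Section UniformSample.
Context (d : measure_display) (T : measurableType d) (R : realType).
Context (P : probability T R) (X : nat -> T -> nat) (n : nat).
Context (n0 : (0 < n)%N).
Context (Xind : mutual_indep P predT (fun j w => ((X j w)%:R : R))).
Context (Xunif : forall j i, (1 <= i <= n)%N ->
  P [set w | X j w = i] = ((n%:R : R)^-1)%:E).

Lemma measurable_sample j (A : set nat) : measurable (X j @^-1` A).
Proof. exact: measurable_nat_preimage (Xind.1 j isT). Qed.

Lemma sample_indep (J : seq nat) (A : nat -> set nat) : uniq J ->
  P (\bigcap_(j in [set j | j \in J]) (X j @^-1` A j)) =
  (\prod_(j <- J) P (X j @^-1` A j))%E.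
Proof.
move=> uJ; have := Xind.2 J (fun j => [set (i%:R : R) | i in A j]) uJ (fun _ _ => isT)
  (fun j => @measurable_natr_image R (A j)).
under eq_bigcapr do rewrite natr_image_preimage.
by under eq_bigr do rewrite natr_image_preimage.
Qed.

Lemma sample_indep2 i j (A B : set nat) : i != j ->
  P ((X i @^-1` A) `&` (X j @^-1` B)) = (P (X i @^-1` A) * P (X j @^-1` B))%E.
Proof.
move=> ij; have ji : (j == i) = false by rewrite eq_sym (negbTE ij).
have := @sample_indep [:: i; j] (fun l => if l == i then A else B).
rewrite /= inE ij => /(_ isT); rewrite !big_cons big_nil eqxx ji mule1 => <-.
congr (P _); apply/seteqP; split=> w /=.
  move=> [Ai Bj] l /=; rewrite !inE => /orP[] /eqP ->; rewrite ?eqxx ?ji //.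
move=> h; split.
  by have := h i; rewrite /= !inE eqxx; apply.
by have := h j; rewrite /= !inE ji eqxx orbT; apply.
Qed.

Lemma prob_sample_in j (a : pred nat) (N : nat) : (N <= n)%N ->
  P [set w | a (X j w) && (1 <= X j w <= N)%N] =
  ((\sum_(1 <= i < N.+1) (a i)%:R) / n%:R)%:E.
Proof.
elim: N => [|N IH] Nn.
  rewrite big_nil mul0r (_ : [set w | _] = set0) ?measure0 //.
  by apply/seteqP; split => w //=; case: (X j w) => [|m]; rewrite ?andbF.
rewrite big_nat_recr //= mulrDl EFinD -IH 1?ltnW //.
have -> : ((a N.+1)%:R / n%:R)%:E = P [set w | a (X j w) && (X j w == N.+1)].
  case: (boolP (a N.+1)) => aN.
    rewrite mul1r -(@Xunif j N.+1) ?Nn //; congr (P _); apply/seteqP; split => w /=.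
      by move=> ->; rewrite aN eqxx.
    by move=> /andP[_ /eqP].
  rewrite mul0r (_ : [set w | _] = set0) ?measure0 //.
  by apply/seteqP; split => w //= /andP[+ /eqP Xw]; rewrite Xw (negbTE aN).
rewrite -measureU; last 1 first.
- apply/seteqP; split => w //= [/andP[_ /andP[_ XN]] /andP[_ /eqP XN1]].
  by rewrite XN1 ltnn in XN.
- congr (P _); apply/seteqP; split => w /=.
    move=> /andP[aw /andP[X1 XN]]; rewrite aw X1 /=.
    by move: XN; rewrite leq_eqVlt ltnS => /orP[->|->]; [right|left].
  by case=> /andP[-> /=]; [move=> /andP[-> /leqW ->]|move=> /eqP ->; rewrite leqnn].
- exact: (@measurable_sample j [set i | a i && (1 <= i <= N)%N]).
- exact: (@measurable_sample j [set i | a i && (i == N.+1)]).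
Qed.

(** The [n] point masses [1 / n] already exhaust the total mass. *)
Lemma prob_sample_out j : P [set w | ~~ (1 <= X j w <= n)%N] = 0%E.
Proof.
have -> : [set w | ~~ (1 <= X j w <= n)%N] = ~` [set w | predT (X j w) && (1 <= X j w <= n)%N].
  by apply/seteqP; split => w /=; [move/negP|move=> ?; apply/negP].
rewrite probability_setC; last exact: (@measurable_sample j [set i | (1 <= i <= n)%N]).
rewrite prob_sample_in // sumr_const_nat subSS subn0 divff ?subee //.
by rewrite pnatr_eq0 -lt0n.
Qed.

Lemma prob_sample j (a : pred nat) :
  P [set w | a (X j w)] = (avg n (fun i => (a i)%:R))%:E.
Proof.
rewrite /avg -(@prob_sample_in j) //.
have mI : measurable [set w | a (X j w) && (1 <= X j w <= n)%N].
  exact: (@measurable_sample j [set i | a i && (1 <= i <= n)%N]).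
have mO : measurable [set w | a (X j w) && ~~ (1 <= X j w <= n)%N].
  exact: (@measurable_sample j [set i | a i && ~~ (1 <= i <= n)%N]).
have -> : [set w | a (X j w)] = [set w | a (X j w) && (1 <= X j w <= n)%N] `|`
    [set w | a (X j w) && ~~ (1 <= X j w <= n)%N].
  apply/seteqP; split => w /=; last by case=> /andP[].
  by move=> ->; case: (1 <= X j w <= n)%N; [left|right].
rewrite measureU //; last first.
  by apply/seteqP; split => w //= [/andP[_ ->]]; rewrite andbF.
rewrite [X in (_ + X)%E](_ : _ = 0%E) ?adde0 //.
apply/eqP; rewrite -measure_le0 -(prob_sample_out j); apply: le_measure; rewrite ?inE //.
  exact: (@measurable_sample j [set i | ~~ (1 <= i <= n)%N]).
by move=> w /= /andP[].
Qed.

Lemma prod_bool (I : Type) (s : seq I) (a : pred I) :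
  \prod_(i <- s) (a i)%:R = (all a s)%:R :> R.
Proof.
elim: s => [|i s IH]; first by rewrite big_nil.
by rewrite big_cons IH /= -mulnb natrM.
Qed.

Definition sample_grid k w : grid k :=
  discretize k (fun j => (X j w)%:R / n%:R : R) (fun j p => logn p (X j w)).

Definition sample_type k (z : grid k) j : pred nat := fun i =>
  (cell k (i%:R / n%:R : R) == (z (inord j)).1) &&
  all (fun p => minn (logn p i) k == (z (inord j)).2 (inord p)) (iota 0 k.+1).

(** Each coordinate of [z] constrains a single draw, the shape that independence turns into a
    product. *)
Lemma sample_grid_preimage k (z : grid k) : sample_grid k @^-1` [set z] =
  \bigcap_(j in [set j | j \in iota 0 k.+1]) (X j @^-1` [set i | sample_type z j i]).
Proof.
have memE i : (i \in iota 0 k.+1) = (i < k.+1)%N by rewrite mem_iota.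
have memI i : (i < k.+1)%N -> i \in iota 0 k.+1 by rewrite memE.
apply/seteqP; split => w.
  move=> /discretize_eqP h j; move=> jI; have jk : (j < k.+1)%N by rewrite -memE.
  have [hc hp] := h j jk; rewrite /preimage /= /sample_type hc eqxx andTb.
  apply/(@allP _ _ (iota 0 k.+1)) => p; rewrite memE => pk.
  rewrite -(hp p pk) /prime_part; case: ifP => // npp; by rewrite lognE npp.
move=> h; apply/discretize_eqP => j jk.
have /andP[/eqP -> /allP hp] : sample_type z j (X j w) by exact: h (memI j jk).
split=> // p pk; have /eqP <- := hp p (memI p pk).
by rewrite /prime_part; case: ifP => // npp; rewrite lognE npp.
Qed.

Lemma measurable_sample_grid k (z : grid k) : measurable (sample_grid k @^-1` [set z]).
Proof.
rewrite sample_grid_preimage; apply: fin_bigcap_measurable.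
  exact: finite_seq.
by move=> j _; exact: measurable_sample.
Qed.

Lemma prob_sample_grid k (z : grid k) :
  fine (P (sample_grid k @^-1` [set z])) = \prod_(j <- iota 0 k.+1)
    avg n (fun i => (cell k (i%:R / n%:R : R) == (z (inord j)).1)%:R *
      \prod_(p <- iota 0 k.+1) (minn (logn p i) k == (z (inord j)).2 (inord p))%:R).
Proof.
rewrite sample_grid_preimage (@sample_indep _ (fun j => [set i | sample_type z j i])) ?iota_uniq //.
rewrite (eq_bigr (fun j => (avg n (fun i => (sample_type z j i)%:R))%:E)); last first.
  by move=> j _; rewrite -(prob_sample j).
rewrite prod_EFin /=; apply: eq_bigr => j _; congr (_ / _); apply: eq_bigr => i _.
by rewrite prod_bool /sample_type -mulnb natrM.
Qed.

Lemma avg_dvd_le p : avg n (fun i => (p %| i)%:R) <= p%:R^-1 :> R.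
Proof.
case: p => [|p].
  rewrite invr0 /avg big_nat big1 ?mul0r // => i /andP[i1 _].
  by rewrite dvd0n gtn_eqF.
have -> : avg n (fun i => (p.+1 %| i)%:R) = (n %/ p.+1)%:R / n%:R :> R.
  by rewrite /avg divn_count_dvd natr_sum.
rewrite ler_pdivrMr ?ltr0n // mulrC.
by rewrite ler_pdivlMr ?ltr0n // -natrM ler_nat leq_divM.
Qed.

Lemma avg_ratio_le (y : R) : 0 <= y ->
  avg n (fun i => (i%:R / n%:R <= y)%R%:R) <= y.
Proof.
move=> y0; rewrite ler_pdivrMr ?ltr0n //.
have yn0 : 0 <= y * n%:R by rewrite mulr_ge0.
rewrite (eq_bigr (fun i => (i%:R <= y * n%:R)%R%:R)); last first.
  by move=> i _; rewrite ler_pdivrMr ?ltr0n.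
(* With [c] fixed, induction on the length shows that at most [c] positive integers are below [c];
   if [N.+1 <= c], the trivial count suffices. *)
move: (y * n%:R) yn0 => c c0; elim: n => [|N IH]; first by rewrite big_nil.
rewrite big_nat_recr //=; case: (lerP N.+1%:R c) => yN; last by rewrite addr0.
apply: le_trans yN; rewrite -[leRHS]natr1 lerD2r.
rewrite -[leRHS](_ : \sum_(1 <= i < N.+1) 1 = N%:R); last by rewrite sumr_const_nat subSS subn0.
by apply: ler_sum => i _; rewrite lern1 leq_b1.
Qed.

Lemma sample_out_le j : outer_le P [set w | ~~ (1 <= X j w <= n)%N] 0.
Proof.
apply: outer_le_measurable; last by rewrite prob_sample_out.
exact: (@measurable_sample j [set i | ~~ (1 <= i <= n)%N]).
Qed.

Lemma sample_pair_le i j (a b : pred nat) (r : R) : i != j ->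
  avg n (fun l => (a l)%:R) <= r -> avg n (fun l => (b l)%:R) <= r ->
  outer_le P [set w | a (X i w) /\ b (X j w)] (r * r).
Proof.
move=> ij ar br; apply: outer_le_measurable.
  by apply: measurableI; [exact: (@measurable_sample i [set l | a l])|
                          exact: (@measurable_sample j [set l | b l])].
rewrite -/([set w | a (X i w)] `&` [set w | b (X j w)]).
rewrite (@sample_indep2 i j [set l | a l] [set l | b l]) // !prob_sample -EFinM lee_fin.
have avg0 c : 0 <= avg n (fun l => (c l : bool)%:R) :> R.
  by rewrite divr_ge0 // sumr_ge0.
by apply: ler_pM.
Qed.

(** A union over the [n] common values, each of probability [1 / n ^ 2], together with the null
    event of a draw outside the range. *)
Lemma sample_collision_le i j : i != j ->
  outer_le P [set w | X i w = X j w] n%:R^-1.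
Proof.
move=> ij; have avg1 v : (1 <= v <= n)%N -> avg n (fun l => (l == v)%:R) = n%:R^-1 :> R.
  by move=> vn; apply: EFin_inj; rewrite -(prob_sample i (pred1 v)) -(@Xunif i v) //;
    congr (P _); apply/seteqP; split => w /=; [move/eqP|move=> ->].
have h := outer_leU (sample_out_le i) (@outer_le_exists _ _ _ P (index_iota 1 n.+1)
  (fun v => [set w | X i w == v /\ X j w == v]) (fun=> n%:R^-1 * n%:R^-1) _).
apply: outer_le_sub (h _) => [w /= Xij||v]; last first.
- rewrite mem_index_iota => vn; apply: (@sample_pair_le i j (pred1 v) (pred1 v)) => //.
    by rewrite avg1.
  by rewrite avg1.
- rewrite add0r sumr_const_nat subSS subn0 -[leLHS]mulr_natl mulrA divff ?mul1r //.
  by rewrite pnatr_eq0 -lt0n.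
- case: (boolP (1 <= X i w <= n)%N) => [h1|h1]; [right|by left].
  by exists (X i w); rewrite ?mem_index_iota // -Xij eqxx.
Qed.

End UniformSample.

(** Telescoping: [1 / p ^ 2] is at most [1 / (p - 1) - 1 / p]. *)
Lemma sum_inv_sqr_le (R : realType) k N : (0 < k)%N ->
  \sum_(k.+1 <= p < N) (p%:R^-1 * p%:R^-1) <= k%:R^-1 :> R.
Proof.
move=> k0; have [Nk|/ltnW kN] := leqP N k.+1.
  by rewrite big_geq // invr_ge0.
rewrite -(subnKC kN); move: (N - k.+1)%N => L.
suff : \sum_(k.+1 <= p < k.+1 + L) (p%:R^-1 * p%:R^-1) <=
    k%:R^-1 - (k + L)%:R^-1 :> R.
  by move=> /le_trans; apply; rewrite gerBl invr_ge0.
elim: L => [|L IH]; first by rewrite !addn0 big_geq // subrr.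
rewrite addnS big_nat_recr ?leq_addr //= addSn addnS.
rewrite addSn in IH; move: (k + L)%N (leq_trans k0 (leq_addr L k)) IH => q q0 IH.
have q1 : 0 < q%:R :> R by rewrite ltr0n.
have : q.+1%:R^-1 * q.+1%:R^-1 <= q%:R^-1 - q.+1%:R^-1 :> R.
  have -> : q%:R^-1 - q.+1%:R^-1 = q%:R^-1 * q.+1%:R^-1 :> R.
    by rewrite -natr1; field; rewrite !gt_eqF //; lra.
  by rewrite ler_wpM2r ?invr_ge0 // lef_pV2 ?posrE ?ltr0n // ler_nat.
by move=> h; apply: le_trans (lerD IH h) _; rewrite addrA subrK.
Qed.

(** Serves to turn [k] events of probability at most [2 ^ - k.+1], one per base whose [k.+1]-st
    power divides a draw, into a total of order [1 / k]. *)
Lemma sqr_le_pow2 k : (k * k <= 2 ^ k.+1)%N.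
Proof.
case: (ltnP k 4) => [|k4]; first by case: k => [|[|[|[|k]]]].
rewrite -(subnKC k4); elim: (k - 4)%N => [//|L IH].
by rewrite addnS expnS; move: IH; move: (2 ^ _)%N => q; nia.
Qed.

(** * Exceptional events for the discretized sample *)

Section SampleApproximation.
Context (d : measure_display) (T : measurableType d) (R : realType).
Context (P : probability T R).

(** Lets a union bound over ordered pairs run over the full square of indices. *)
Lemma outer_le_cond (b : bool) (A : set T) (r : R) : 0 <= r ->
  (b -> outer_le P A r) -> outer_le P [set w | b /\ A w] r.
Proof.
case: b => r0 h; first by apply: outer_le_sub (h isT) => // w [].
by exists set0; split=> [|w []|] //; rewrite measure0 lee_fin.
Qed.

Lemma sum_index_const (c : R) M : \sum_(i <- index_iota 0 M) c = M%:R * c.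
Proof. by rewrite sumr_const_nat subn0 mulr_natl. Qed.

Context (X : nat -> T -> nat) (n : nat) (n0 : (0 < n)%N).
Context (Xind : mutual_indep P predT (fun j w => ((X j w)%:R : R))).
Context (Xunif : forall j i, (1 <= i <= n)%N ->
  P [set w | X j w = i] = ((n%:R : R)^-1)%:E).

Lemma sample_grid_close (M k : nat) (dl : R) : (M < n)%N -> (0 < k)%N ->
  (M <= k)%N -> 0 < dl -> n%:R^-1 <= dl -> k%:R^-1 <= dl ->
  exists B : set T, [/\ measurable B,
    (P B <= (5 * (M%:R + 1) ^+ 2 * dl)%:E)%E &
    forall w, ~ B w -> forall m, (m < M)%N ->
      `|lcm_vector R n (X^~ w) m - grid_vector R (sample_grid R X n k w) m|
        <= M%:R / (dl * k%:R)].
Proof.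
move=> Mn k0 Mk dl0 ndl kdl; set K := k.+1.
pose I := index_iota 0 M.
(* Avoiding [E1] and [E2] makes [Bset] the set of the first draws; avoiding [E3] removes the primes
   above [k]; avoiding [E4] makes the cap exact; avoiding [E5] keeps [ln] Lipschitz on the rescaled
   draws. *)
pose E1 := [set w | exists2 j, j \in I & ~~ (1 <= X j w <= n)%N].
pose E2 := [set w | exists2 i, i \in I & exists2 j, j \in I & (i < j)%N /\ X i w = X j w].
pose E3 := [set w | exists2 i, i \in I & exists2 j, j \in I & (i < j)%N /\
  exists2 p, p \in index_iota K n.+1 & (p %| X i w)%N /\ (p %| X j w)%N].
pose E4 := [set w | exists2 j, j \in I & exists2 p, p \in index_iota 2 K.+1 &
  (p ^ K %| X j w)%N].
pose E5 := [set w | exists2 j, j \in I & (X j w)%:R / n%:R <= dl].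
have h1 : outer_le P E1 (M%:R * 0).
  by rewrite -sum_index_const; apply: outer_le_exists => j _; exact: sample_out_le.
have h2 : outer_le P E2 (M%:R * (M%:R * n%:R^-1)).
  rewrite -2!sum_index_const; apply: outer_le_exists => i _.
  apply: outer_le_exists => j _; apply: outer_le_cond; first by rewrite invr_ge0.
  by move=> ij; apply: sample_collision_le => //; rewrite ltn_eqF.
have h3 : outer_le P E3 (M%:R * (M%:R * k%:R^-1)).
  rewrite -2!sum_index_const; apply: outer_le_exists => i _.
  apply: outer_le_exists => j _; apply: outer_le_cond; first by rewrite invr_ge0.
  move=> ij; apply: (@outer_le_sub _ _ _ P _ _ _ _ (fun w h => h) (sum_inv_sqr_le R n.+1 k0)).
  apply: outer_le_exists => p _.
  by apply: (sample_pair_le n0 Xind Xunif (a := dvdn p) (b := dvdn p)); rewrite ?ltn_eqF ?avg_dvd_le.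
have h4 : outer_le P E4 (M%:R * (2 * k%:R^-1)).
  rewrite -sum_index_const; apply: outer_le_exists => j _.
  have sum_le : \sum_(p <- index_iota 2 K.+1) (2 ^ K)%N%:R^-1 <= 2 * k%:R^-1 :> R.
    rewrite sumr_const_nat subSS -[leLHS]mulr_natr mulrC.
    rewrite ler_pdivrMr ?ltr0n ?expn_gt0 // mulrAC ler_pdivlMr ?ltr0n // -!natrM ler_nat.
    by rewrite -expnS (leq_trans _ (sqr_le_pow2 K)) // leq_mul // ?leq_subr // leqW.
  apply: (@outer_le_sub _ _ _ P _ _ _ _ (fun w h => h) sum_le).
  apply: outer_le_exists => p; rewrite mem_index_iota => /andP[p2 _].
  apply: outer_le_measurable; first exact: (measurable_sample Xind j [set i | (p ^ K %| i)%N]).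
  rewrite (prob_sample n0 Xind Xunif j (dvdn (p ^ K))) lee_fin.
  apply: (le_trans (avg_dvd_le _ n0 _)); rewrite lef_pV2 ?posrE ?ltr0n ?expn_gt0 ?(ltnW p2) //.
  by rewrite ler_nat leq_exp2r.
have h5 : outer_le P E5 (M%:R * dl).
  rewrite -sum_index_const; apply: outer_le_exists => j _.
  apply: outer_le_measurable.
    exact: (measurable_sample Xind j [set i | (i%:R / n%:R <= dl)]).
  rewrite (prob_sample n0 Xind Xunif j (fun i => i%:R / n%:R <= dl)) lee_fin.
  by apply: avg_ratio_le => //; exact: ltW.
have [B [mB EB PB]] := outer_leU (outer_leU (outer_leU (outer_leU h1 h2) h3) h4) h5.
exists B; split=> // [|w Bw m mM].
  apply: (le_trans PB); rewrite lee_fin.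
  (* The five bounds add up to at most [(2 * M ^ 2 + 3 * M) * dl], which [5 * (M + 1) ^ 2 * dl]
     covers. *)
  have M0 : 0 <= M%:R :> R by [].
  have : M%:R * (M%:R * n%:R^-1) <= M%:R * (M%:R * dl) by rewrite !ler_wpM2l.
  have : M%:R * (M%:R * k%:R^-1) <= M%:R * (M%:R * dl) by rewrite !ler_wpM2l.
  have : M%:R * (2 * k%:R^-1) <= M%:R * (2 * dl) by rewrite !ler_wpM2l.
  have : 0 <= M%:R * dl by rewrite mulr_ge0 // ltW.
  have : 0 <= M%:R * (M%:R * dl) by rewrite !mulr_ge0 // ltW.
  by rewrite expr2; move: dl0; nra.
have nE : ~ (E1 `|` E2 `|` E3 `|` E4 `|` E5) w by move=> /EB.
have inI j : (j <= m)%N -> j \in I.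
  by move=> jm; rewrite mem_index_iota /= (leq_ltn_trans jm).
have Xin j : (j <= m)%N -> (1 <= X j w <= n)%N.
  move=> jm; apply: contrapT => /negP Xj; apply: nE; do 4 left.
  by exists j; rewrite ?inI.
have X0 j : (j <= m)%N -> (0 < X j w)%N by move=> /Xin /andP[].
have Xdiff i j : (i < j <= m)%N -> X i w != X j w.
  move=> /andP[ij jm]; apply/eqP => Xij; apply: nE; do 3 left; right.
  exists i; first by rewrite inI // (leq_trans (ltnW ij)).
  by exists j; rewrite ?inI.
have Xcop p i j : prime p -> (K <= p)%N -> (i < j <= m)%N ->
    logn p (X i w) = 0%N \/ logn p (X j w) = 0%N.
  move=> pp Kp /andP[ij jm]; have im : (i <= m)%N by rewrite (leq_trans (ltnW ij)).
  case: (posnP (logn p (X i w))) => [->|]; [by left|]; rewrite logn_gt0 mem_primes => /and3P[_ _ pi].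
  case: (posnP (logn p (X j w))) => [->|]; [by right|]; rewrite logn_gt0 mem_primes => /and3P[_ _ pj].
  exfalso; apply: nE; do 2 left; right.
  exists i; rewrite ?inI //; exists j; rewrite ?inI //; split=> //.
  exists p => //; rewrite mem_index_iota Kp ltnS /=.
  have /andP[_ Xin2] := Xin i im.
  exact: leq_trans (dvdn_leq (X0 i im) pi) Xin2.
have mn : (m < n)%N by apply: leq_trans Mn; exact: leqW.
have mk : (m <= k)%N by apply: leq_trans Mk; exact: ltnW.
have Xeta j : (j <= m)%N -> dl < ((X j w)%:R / n%:R : R) <= 1.
  move=> jm; apply/andP; split; last first.
    by rewrite ler_pdivrMr ?ltr0n // mul1r ler_nat; have /andP[] := Xin j jm.
  by rewrite ltNge; apply/negP => hj; apply: nE; right; exists j; rewrite ?inI.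
have Xval p j : prime p -> (p <= k)%N -> (j <= m)%N -> (logn p (X j w) <= k)%N.
  move=> pp pk jm; rewrite leqNgt; apply/negP => hk; apply: nE; left; right.
  exists j; rewrite ?inI //; exists p; last by rewrite pfactor_dvdn ?X0.
  by rewrite mem_index_iota prime_gt1 // ltnS (leqW pk).
have := @grid_vector_dist R k (fun j => (X j w)%:R / n%:R) (fun j p => logn p (X j w)) m
  (lcm_vector R n (X^~ w) m) dl mk dl0 Xeta Xval
  (@lcm_vector_sample R n (X^~ w) m K mn X0 Xdiff Xcop).
move=> /le_trans; apply; apply: ler_pM => //.
- by rewrite invr_ge0 mulr_ge0 // ltW.
- by rewrite ler_nat.
- rewrite lef_pV2 ?posrE ?mulr_gt0 ?ltr0n //.
  by rewrite ler_pM2l // ler_nat.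
Qed.

End SampleApproximation.

(** * The limiting variables *)

(** For fixed [m] only finitely many pairs occur, so one [N0] serves them all. Once [k] exceeds [N0]
    and the finitely many valuations at primes below it, the arithmetic part is constant and only
    the logarithms still move. *)
Lemma grid_vector_cvg (R : realType) (x : nat -> R) (l : nat -> nat -> nat) m :
  (forall j, 0 < x j <= 1) ->
  (forall i j, (i < j)%N -> exists N0, forall p, prime p -> (N0 <= p)%N ->
     l i p = 0%N \/ l j p = 0%N) ->
  (fun k => grid_vector R (discretize k x l) m) @ \oo --> limit_vector l x m.
Proof.
move=> x01 hl.
have [N0 hN0] : exists N0, forall p i j, prime p -> (N0 <= p)%N -> (i < j <= m)%N ->
    l i p = 0%N \/ l j p = 0%N.
  have : \forall p \near \oo, forall i, (i < m.+1)%N -> forall j, (j < m.+1)%N ->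
      (i < j)%N -> prime p -> l i p = 0%N \/ l j p = 0%N.
    apply: near_forall_ltn => i; apply: near_forall_ltn => j.
    have [ij|ji] := ltnP i j; last by apply: nearW => p.
    by have [N0 h] := hl i j ij; exists N0 => // p N0p _ pp; exact: h.
  case=> N0 _ h; exists N0 => p i j pp N0p /andP[ij jm].
  by apply: (h p N0p i) => //; rewrite ltnS // (leq_trans (ltnW ij)).
rewrite (limit_vector_sample x hN0).
apply: (@cvg_trans _ ((fun k => \sum_(j < m.+1) ln ((cell k (x j)).+1%:R / k.+1%:R : R) +
   \sum_(p < N0 | prime p) lcm_defect R l m p) @ \oo)).
  apply: near_eq_cvg; near=> k.
  rewrite grid_vector_discretize; last by near: k; exact: nbhs_infty_ge.
  congr (_ + _).
  rewrite (@sum_lcm_defect_stable _ _ _ N0); first last.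
  - move=> p i j pp N0p ijm; case: (hN0 p i j pp N0p ijm) => ->; rewrite min0n; by [left|right].
  - by apply: leqW; near: k; exact: nbhs_infty_ge.
  apply: eq_bigr => p pp; rewrite /lcm_defect.
  have lk : forall j, (j < m.+1)%N -> forall p, (p < N0)%N -> (l j p <= k)%N.
    near: k; apply: near_forall_ltn => j; apply: near_forall_ltn => q.
    exact: nbhs_infty_ge.
  have e (j : 'I_m.+1) : minn (l j p) k = l j p by apply/minn_idPl; exact: lk.
  by rewrite (eq_bigr _ (fun j _ => e j)) [in X in _ = _ * (_ - X%:R)](eq_bigr _ (fun j _ => e j)).
apply: cvgD; last exact: cvg_cst.
by apply: cvg_sum_seq => j; exact: cell_ln_cvg.
Unshelve. all: by end_near. Qed.

Section LimitVariables.
Context (d : measure_display) (T : measurableType d) (R : realType).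
Context (P : probability T R) (G : nat -> nat -> T -> nat) (V : nat -> T -> R).
Context (Hind : mutual_indep P
  (fun x : (nat * nat) + nat => match x with inl kp => prime kp.2 | inr _ => true end)
  (fun x w => match x with inl kp => ((G kp.1 kp.2 w)%:R : R) | inr j => V j w end)).
Context (HG : forall k p j, prime p ->
  P [set w | (j <= G k p w)%N] = (((p%:R : R)^-1) ^+ j)%:E).
Context (HV : forall j (x : R),
  P [set w | V j w <= x] = (Num.max 0 (Num.min x 1))%:E).

Lemma measurable_uniform j : measurable_fun setT (V j).
Proof. exact: (Hind.1 (inr j) isT). Qed.

Lemma measurable_geom j p (A : set nat) : prime p -> measurable (G j p @^-1` A).
Proof. by move=> pp; exact: measurable_nat_preimage (Hind.1 (inl (j, p)) pp). Qed.

Lemma measurable_cell_lt k b : (b <= k.+1)%N -> measurable [set x : R | (cell k x < b)%N].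
Proof.
move=> bk; case: (eqVneq b k.+1) => [bK|bK].
  rewrite (_ : [set x | _] = setT) //; apply/seteqP; split => x //= _.
  by rewrite cell_lt // bK eqxx.
case: (posnP b) => [->|b0].
  by rewrite (_ : [set x | _] = set0) //; apply/seteqP; split => x //=; rewrite ltn0.
rewrite (_ : [set x | _] = `]-oo, (b%:R / k.+1%:R)]%classic); first exact: measurable_itv.
by apply/seteqP; split => x /=; rewrite in_itv /= cell_lt // (negbTE bK) b0.
Qed.

Lemma measurable_cell_eq k a : (a <= k)%N -> measurable [set x : R | cell k x = a].
Proof.
move=> ak; rewrite (_ : [set x | _] = [set x : R | (cell k x < a.+1)%N] `\`
    [set x | (cell k x < a)%N]).
  by apply: measurableD; apply: measurable_cell_lt; rewrite // leqW.
apply/seteqP; split => x /=; first by move=> ->; rewrite ltnn ltnSn.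
by move=> [h1 /negP h2]; apply/eqP; rewrite eqn_leq -ltnS h1 leqNgt.
Qed.

Lemma prob_cell_lt k j b : (b <= k.+1)%N ->
  P [set w | (cell k (V j w) < b)%N] = (b%:R / k.+1%:R)%:E.
Proof.
move=> bk; case: (eqVneq b k.+1) => [bK|bK].
  rewrite (_ : [set w | _] = setT) ?probability_setT ?bK ?divff ?pnatr_eq0 //.
  by apply/seteqP; split => w //= _; rewrite ltnS cell_le.
case: (posnP b) => [->|b0].
  rewrite mul0r (_ : [set w | _] = set0) ?measure0 //.
  by apply/seteqP; split => x //=; rewrite ltn0.
have bk1 : b%:R / k.+1%:R <= 1 :> R by rewrite ler_pdivrMr // mul1r ler_nat.
rewrite (_ : [set w | _] = [set w | V j w <= b%:R / k.+1%:R]).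
  by rewrite HV (min_idPl bk1) (max_idPr _) // divr_ge0.
by apply/seteqP; split => x /=; rewrite cell_lt // (negbTE bK) b0.
Qed.

Lemma prob_cell_eq k j a : (a <= k)%N ->
  P [set w | cell k (V j w) = a] = (k.+1%:R^-1)%:E.
Proof.
move=> ak; rewrite (_ : [set w | _] = [set w | (cell k (V j w) < a.+1)%N] `\`
    [set w | (cell k (V j w) < a)%N]); last first.
  apply/seteqP; split => x /=; first by move=> ->; rewrite ltnn ltnSn.
  by move=> [h1 /negP h2]; apply/eqP; rewrite eqn_leq -ltnS h1 leqNgt.
have mc b : (b <= k.+1)%N -> measurable [set w | (cell k (V j w) < b)%N].
  move=> bk; rewrite -[X in measurable X]setTI.
  exact: (measurable_uniform j measurableT (measurable_cell_lt bk)).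
rewrite (prob_diff _ _ _ (@prob_cell_lt k j a.+1 ak) (prob_cell_lt j (leqW ak))).
- by rewrite -mulrBl -natrB // subSnn mul1r.
- exact: mc.
- by apply: mc; rewrite leqW.
- by move=> w /= /leqW.
Qed.

(** A difference of consecutive tails, except at [e = k], where the cap collects the entire tail. *)
Lemma prob_capped_geom k j p e : prime p -> (e <= k)%N ->
  P [set w | minn (G j p w) k = e] = (capped_geom R k p e)%:E.
Proof.
move=> pp; rewrite /capped_geom pp leq_eqVlt => /orP[/eqP ->|ek].
  rewrite ltnn mul0r subr0 -(HG j k pp); congr (P _); apply/seteqP; split => w /=.
    by move=> <-; rewrite geq_minl.
  by move=> /minn_idPr.
rewrite ek mul1r -(prob_diff _ _ _ (HG j e pp) (HG j e.+1 pp)).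
- congr (P _); apply/seteqP; split => w /=; rewrite /minn; case: (ltnP (G j p w) k) => Gk.
  + by move=> <-; split=> //; rewrite ltnn.
  + by move=> ke; rewrite -ke ltnn in ek.
  + by move=> [h1 /negP h2]; apply/eqP; rewrite eqn_leq h1 leqNgt h2.
  + by move=> [_ []]; exact: leq_trans Gk.
- exact: (measurable_geom j [set i | (e <= i)%N] pp).
- exact: (measurable_geom j [set i | (e.+1 <= i)%N] pp).
- by move=> w /= /ltnW.
Qed.

Definition limit_grid k w : grid k := discretize k (V ^~ w) (fun j p => G j p w).

(** * Joint law of the discretized limit variables *)

Section LawOfGrid.
Context (k : nat) (z : grid k).
Let K := k.+1.
Let a j : nat := (z (inord j)).1.
Let e j p : nat := (z (inord j)).2 (inord p).
(** Independence is available at prime indices only, so the composite ones are filtered out here and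
    handled by [prime_ok]. *)
Let J : seq ((nat * nat) + nat) := [seq inr j | j <- iota 0 K] ++
  [seq inl (j, p) | j <- iota 0 K, p <- [seq p <- iota 0 K | prime p]].
Let B (x : (nat * nat) + nat) : set R := match x with
  | inl jp => [set i%:R | i in [set i | minn i k = e jp.1 jp.2]]
  | inr j => [set y | cell k y = a j] end.
Let r (x : (nat * nat) + nat) : R := match x with
  | inl jp => capped_geom R k jp.2 (e jp.1 jp.2) | inr j => K%:R^-1 end.
Let W (x : (nat * nat) + nat) (w : T) : R :=
  match x with inl kp => (G kp.1 kp.2 w)%:R | inr j => V j w end.

Let a_le j : (a j <= k)%N. Proof. by rewrite -ltnS /a. Qed.
Let e_le j p : (e j p <= k)%N. Proof. by rewrite -ltnS /e. Qed.

Let mem_inr j : (inr j \in J) = (j < K)%N.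
Proof.
rewrite mem_cat mem_map; last by move=> ? ? [].
rewrite mem_iota add0n; case: (ltnP j K) => // _; rewrite orFb; apply/negbTE/negP.
by move=> /allpairsPdep[? [? []]].
Qed.

Let mem_inl j p : (inl (j, p) \in J) = [&& (j < K)%N, (p < K)%N & prime p].
Proof.
rewrite mem_cat; have -> : (inl (j, p) \in [seq inr j | j <- iota 0 K]) = false.
  by apply/negbTE/negP => /mapP[].
apply/allpairsPdep/and3P => [[j' [p' [+ + [-> ->]]]]|[jK pK pp]].
  by rewrite mem_filter !mem_iota => ? /andP[].
by exists j, p; rewrite mem_filter !mem_iota pp.
Qed.

Let uniq_J : uniq J.
Proof.
rewrite cat_uniq map_inj_uniq ?iota_uniq; last by move=> ? ? [].
rewrite andTb allpairs_uniq ?filter_uniq ?iota_uniq ?andbT //; last by move=> [? ?] [? ?] _ _ [-> ->].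
by apply/hasPn => x /allpairsPdep[j [p [_ _ ->]]]; apply/negP => /mapP[].
Qed.

Let B_measurable x : measurable (B x).
Proof.
by case: x => [jp|j] /=; [exact: measurable_natr_image | exact: measurable_cell_eq].
Qed.

Let prob_B x : x \in J -> P (W x @^-1` B x) = (r x)%:E.
Proof.
case: x => [[j p]|j] /=.
  rewrite mem_inl => /and3P[jK pK pp]; rewrite natr_image_preimage.
  exact: prob_capped_geom.
by move=> _; exact: prob_cell_eq.
Qed.

(** A grid point with a nonzero entry at a composite index is never attained; the product formula
    also gives 0 there, through the composite case of [capped_geom]. *)
Let prime_ok := all (fun j => all (fun p => prime p || (e j p == 0%N)) (iota 0 K)) (iota 0 K).

Let limit_grid_preimage : prime_ok -> limit_grid k @^-1` [set z] =
  \bigcap_(x in [set x | x \in J]) (W x @^-1` B x).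
Proof.
move=> ok; apply/seteqP; split => w.
  move=> /discretize_eqP h [[j p]|j]; rewrite /mkset ?mem_inl ?mem_inr => jI.
    have /and3P[jK pK pp] := jI; have [_ /(_ p pK)] := h j jK.
    by rewrite /prime_part pp => hp; exists (G j p w).
  exact: (h j jI).1.
move=> h; apply/discretize_eqP => j jK; split; first by apply: (h (inr j)); rewrite /mkset mem_inr.
move=> p pK; rewrite /prime_part; case: ifP => pp; last first.
  have memI i : (i < K)%N -> i \in iota 0 K by rewrite mem_iota.
  have := allP (allP ok j (memI j jK)) p (memI p pK); rewrite pp /= => /eqP ejp.
  by rewrite min0n -[RHS]/(e j p) ejp.
have : (W (inl (j, p)) @^-1` B (inl (j, p))) w by apply: h; rewrite /mkset mem_inl jK pK.
by rewrite /B /W natr_image_preimage.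
Qed.

Let limit_grid_preimage0 : ~~ prime_ok -> limit_grid k @^-1` [set z] = set0.
Proof.
move=> ok; apply/seteqP; split => // w /discretize_eqP h; case/negP: ok.
apply/allP => j; rewrite mem_iota => jK; apply/allP => p; rewrite mem_iota => pK.
case: (boolP (prime p)) => //= npp; have [_ /(_ p pK)] := h j jK.
by rewrite /prime_part (negbTE npp) min0n /e => <-.
Qed.

Lemma measurable_limit_grid : measurable (limit_grid k @^-1` [set z]).
Proof.
have [ok|ok] := boolP prime_ok; last by rewrite limit_grid_preimage0.
rewrite limit_grid_preimage //; apply: fin_bigcap_measurable; first exact: finite_seq.
move=> x xJ; rewrite -[X in measurable X]setTI; apply: (Hind.1 x) => //.
by case: x xJ => [[j p]|//]; rewrite /mkset mem_inl => /and3P[].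
Qed.

(** Written as a product over all [p <= k], composite ones included, to coincide with the limits
    given by [avg_cell_valuations_cvg]. *)
Lemma prob_limit_grid : P (limit_grid k @^-1` [set z]) =
  (\prod_(j <- iota 0 K) (K%:R^-1 * \prod_(p <- iota 0 K) capped_geom R k p (e j p)))%:E.
Proof.
have [ok|ok] := boolP prime_ok; last first.
  rewrite limit_grid_preimage0 // measure0; congr EFin; apply/esym/eqP.
  move: ok => /allPn[j jK /allPn[p pK]]; rewrite negb_or => /andP[npp ejp].
  rewrite prodf_seq_eq0; apply/hasP; exists j => //=.
  rewrite mulf_eq0 invr_eq0 pnatr_eq0 /= prodf_seq_eq0; apply/hasP; exists p => //=.
  by rewrite /capped_geom (negbTE npp) (negbTE ejp).
rewrite limit_grid_preimage // (Hind.2 J B uniq_J) //; last first.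
  by case=> [[j p]|//]; rewrite mem_inl => /and3P[].
rewrite (eq_big_seq (fun x => (r x)%:E) prob_B) prod_EFin; congr EFin.
rewrite /J big_cat big_map big_allpairs_dep [RHS]big_split; congr (_ * _).
apply: eq_big_seq => j jK; rewrite big_filter big_mkcond; apply: eq_big_seq => p pK /=.
case: ifP => // npp; have := allP (allP ok j jK) p pK.
by rewrite npp /= /capped_geom npp => ->.
Qed.

End LawOfGrid.

Lemma common_prime_le i j p : (i < j)%N -> prime p ->
  P ((G i p @^-1` [set l | (1 <= l)%N]) `&` (G j p @^-1` [set l | (1 <= l)%N])) =
  (p%:R^-1 * p%:R^-1)%:E.
Proof.
move=> ij pp; have := Hind.2 [:: inl (i, p); inl (j, p)]
  (fun=> [set l%:R | l in [set l | (1 <= l)%N]]).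
rewrite /= inE andbT => /(_ _ _ (fun=> measurable_natr_image _)).
rewrite !big_cons big_nil mule1 /= !natr_image_preimage.
have Gp l : P (G l p @^-1` [set l | (1 <= l)%N]) = (p%:R^-1)%:E.
  by rewrite -[p%:R^-1]expr1 -(HG l 1 pp).
rewrite !Gp -EFinM => <-.
- congr (P _); apply/seteqP; split => w /=.
    move=> [h1 h2] x; rewrite /mkset !inE => /orP[] /eqP -> /=;
      [by exists (G i p w)|by exists (G j p w)].
  move=> h; split.
    have := h (inl (i, p)); rewrite /mkset !inE eqxx => /(_ isT).
    by rewrite natr_image_preimage.
  have := h (inl (j, p)); rewrite /mkset !inE eqxx orbT => /(_ isT).
  by rewrite natr_image_preimage.
- by apply/negP => /eqP[] ij'; rewrite ij' ltnn in ij.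
- by move=> x; rewrite !inE => /orP[] /eqP ->.
Qed.

Lemma common_primes_negligible i j : (i < j)%N ->
  P.-negligible [set w | ~ exists N0, forall p, prime p -> (N0 <= p)%N ->
     G i p w = 0%N \/ G j p w = 0%N].
Proof.
move=> ij.
pose E p : set T := if prime p then
  (G i p @^-1` [set l | (1 <= l)%N]) `&` (G j p @^-1` [set l | (1 <= l)%N]) else set0.
have mE p : measurable (E p).
  by rewrite /E; case: ifP => // pp; apply: measurableI; exact: measurable_geom.
exists (lim_sup_set E); split.
- by apply: bigcapT_measurable => m; apply: bigcup_measurable => p _.
- apply: lim_sup_set_cvg0 => //.
  apply: (@le_lt_trans _ _ 1%:E); last exact: ltry.
  apply: lime_le; first by apply: is_cvg_nneseries => p _ _; exact: measure_ge0.
  (* Since 0 and 1 are not prime the sum starts at 2, and the telescoping bound with [k = 1] makes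
     every partial sum at most 1. *)
  apply: nearW => N; apply: (@le_trans _ _ (\sum_(2 <= p < N) (p%:R^-1 * p%:R^-1 : R))%:E);
    last by rewrite lee_fin (le_trans (sum_inv_sqr_le _ _ (ltn0Sn 0))) // invr1.
  have E01 p : (p < 2)%N -> P (E p) = 0%E.
    by case: p => [|[|]] // _; rewrite /E /= measure0.
  have hp p : (P (E p) <= (p%:R^-1 * p%:R^-1)%:E)%E.
    rewrite /E; case: ifP => pp; first by rewrite common_prime_le.
    by rewrite measure0 lee_fin.
  have [N2|N2] := leqP N 2.
    rewrite (big_geq N2) big_nat big1 // => p /andP[_ pN].
    by apply: E01; exact: leq_trans pN N2.
  rewrite (big_cat_nat (n := 2)) //=; last exact: ltnW.
  rewrite big_nat big1 ?add0e; last by move=> p /andP[_ p2]; exact: E01.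
  rewrite -sumEFin; apply: lee_sum => p _; exact: hp.
- move=> w /= h m _; apply: contrapT => hm; apply: h; exists m => p pp mp.
  case: (posnP (G i p w)) => [|Gi]; [by left|]; case: (posnP (G j p w)) => [|Gj]; [by right|].
  by exfalso; apply: hm; exists p => //; rewrite /E pp.
Qed.

(** Countably many negligible sets, one per index or pair of indices, are covered by one measurable
    null set. *)
Lemma limit_exceptional : exists N : set T, [/\ measurable N, P N = 0%E &
  forall w, ~ N w -> (forall j, 0 < V j w <= 1) /\
    (forall i j, (i < j)%N -> exists N0, forall p, prime p -> (N0 <= p)%N ->
     G i p w = 0%N \/ G j p w = 0%N)].
Proof.
have mV x j : measurable [set w | V j w <= x].
  rewrite -[X in measurable X]setTI (_ : [set w | _] = V j @^-1` `]-oo, x]).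
    exact: (measurable_uniform j measurableT (measurable_itv _)).
  by apply/seteqP; split => w /=; rewrite in_itv.
have nV : P.-negligible (\bigcup_j [set w | ~ (0 < V j w <= 1)]).
  apply: negligible_bigcup => j.
  apply: (@negligibleS _ _ _ _ ([set w | V j w <= 0] `|` ~` [set w | V j w <= 1])).
    move=> w /= h; case: (leP (V j w) 0) => [|V0]; [by left|right=> V1]; apply: h; by rewrite V0.
  apply: negligibleU; apply/negligibleP => //.
  - by apply: (etrans (HV j 0)); rewrite (min_idPl _) // maxxx.
  - exact: measurableC.
  - apply: (etrans (probability_setC P (mV 1 j))).
    by rewrite HV minxx (max_idPr _) // subee.
have nG : P.-negligible (\bigcup_i \bigcup_j [set w | (i < j)%N /\
    ~ exists N0, forall p, prime p -> (N0 <= p)%N ->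
     G i p w = 0%N \/ G j p w = 0%N]).
  apply: negligible_bigcup => i; apply: negligible_bigcup => j.
  have [ij|ji] := boolP (i < j)%N; last first.
    by apply: (@negligibleS _ _ _ _ set0); [move=> w []|exact: negligible_set0].
  by apply: negligibleS (common_primes_negligible ij) => w [].
have [N [mN N0 sub]] := negligibleU nV nG.
exists N; split=> // w Nw; split=> [j|i j ij].
  by apply: contrapT => h; apply: Nw; apply: sub; left; exists j.
by apply: contrapT => h; apply: Nw; apply: sub; right; exists i => //; exists j.
Qed.

End LimitVariables.

Section Approximation.
Context (d : measure_display) (T : measurableType d) (R : realType).
Context (P : probability T R) (U : nat -> nat -> T -> nat).
Context (HUind : forall n, (0 < n)%N ->
  mutual_indep P predT (fun j w => ((U n j w)%:R : R))).
Context (HUunif : forall n j i, (0 < n)%N -> (1 <= i <= n)%N ->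
  P [set w | U n j w = i] = ((n%:R : R)^-1)%:E).

Lemma sample_grid_near_close (M : nat) (del eps : R) : 0 < del -> 0 < eps ->
  \forall k \near \oo, \forall n \near \oo, exists A : set T,
    [/\ measurable A, (P A <= eps%:E)%E &
      forall w, ~ A w -> forall m, (m < M)%N ->
        `|lcm_vector R n ((U n)^~ w) m - grid_vector R (sample_grid R (U n) n k w) m| <= del].
Proof.
(* [c] is the constant of [sample_grid_close], so [dl] makes the exceptional probability [eps].
   Below, [r] is chosen so that [1 / k <= r] gives [M / (dl * k) <= del]; its denominator [M + 1]
   covers [M = 0]. *)
move=> del0 eps0; pose c : R := 5 * (M%:R + 1) ^+ 2; pose dl := eps / c.
have M0 : 0 <= M%:R :> R by [].
have c0 : 0 < c by rewrite mulr_gt0 // exprn_gt0 //; lra.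
have dl0 : 0 < dl by rewrite divr_gt0.
have cdl : c * dl = eps by rewrite mulrC divfK // gt_eqF.
pose r := del * dl / (M%:R + 1).
have Mp : 0 < M%:R + 1 :> R by rewrite ltr_wpDl.
have r0 : 0 < r by rewrite divr_gt0 // mulr_gt0.
near=> k; near=> n.
have n0 : (0 < n)%N by near: n; exact: nbhs_infty_gt.
have Mn : (M < n)%N by near: n; exact: nbhs_infty_gt.
have ndl : n%:R^-1 <= dl by apply/ltW; near: n; exact: near_infty_invn_lt.
have k0 : (0 < k)%N by near: k; exact: nbhs_infty_gt.
have Mk : (M <= k)%N by near: k; exact: nbhs_infty_ge.
have kdl : k%:R^-1 <= dl by apply/ltW; near: k; exact: near_infty_invn_lt.
have kr : k%:R^-1 <= r by apply/ltW; near: k; exact: near_infty_invn_lt.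
have [A [mA PA hA]] := sample_grid_close n0 (HUind n0) (fun j i => @HUunif n j i n0)
  Mn k0 Mk dl0 ndl kdl.
exists A; split=> //; first by rewrite -cdl.
move=> w Aw m mM; apply: (le_trans (hA w Aw m mM)).
rewrite invfM mulrA; apply: (@le_trans _ _ ((M%:R + 1) / dl * r)).
  apply: ler_pM => //; first by rewrite divr_ge0 // ltW.
  by rewrite ler_pM2r ?invr_gt0 // lerDl.
by rewrite /r le_eqVlt; apply/orP; left; apply/eqP; field; rewrite !gt_eqF.
Unshelve. all: by end_near. Qed.

End Approximation.

Theorem theorem3p4 (d : measure_display) (T : measurableType d) (R : realType)
  (P : probability T R)
  (U : nat -> nat -> T -> nat)        (* U n j = U^{(n)}_{j+1} *)
  (G : nat -> nat -> T -> nat)        (* G k p = G_{k+1}(p) *)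
  (V : nat -> T -> R)                 (* V j = U_{j+1} *)
  (HUind : forall n, (0 < n)%N ->
     mutual_indep P predT (fun j w => ((U n j w)%:R : R)))
  (HUunif : forall n j i, (0 < n)%N -> (1 <= i <= n)%N ->
     P [set w | U n j w = i] = ((n%:R : R)^-1)%:E)
  (Hind : mutual_indep P
     (fun x : (nat * nat) + nat => match x with inl kp => prime kp.2 | inr _ => true end)
     (fun x w => match x with inl kp => ((G kp.1 kp.2 w)%:R : R) | inr j => V j w end))
  (HG : forall k p j, prime p ->
     P [set w | (j <= G k p w)%N] = (((p%:R : R)^-1) ^+ j)%:E)
  (HV : forall j (x : R),
     P [set w | V j w <= x] = (Num.max 0 (Num.min x 1))%:E) :
  forall f : {ptws nat -> R} -> R,
    continuous f -> (exists M : R, forall x, `|f x| <= M) ->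
    (fun n : nat => Rintegral P setT (fun w => f (lcm_vector R n (fun j => U n j w))))
      @ \oo --> Rintegral P setT (fun w => f (limit_vector (fun k p => G k p w) (fun j => V j w))).
Proof.
move=> f cf [B fB].
have [N [mN N0 NE]] := limit_exceptional Hind HG HV.
apply: (@cvg_Rintegral_approx _ _ _ P f B
  (fun w => limit_vector (fun k p => G k p w) (V^~ w))
  (fun n w => lcm_vector R n ((U n)^~ w))
  (fun k w => grid_vector R (limit_grid G V k w))
  (fun k n w => grid_vector R (sample_grid R (U n) n k w)) N) => //.
- move=> k g.
  exact: (Rintegral_finite_valued P (fun z => g (grid_vector R z))
    (fun z : grid k => measurable_limit_grid Hind z)).1.
(* Nothing is known of [U 0], so measurability of the sample grid holds only from [n = 1] on. *)
- move=> k; near=> n => g.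
  have n0 : (0 < n)%N by near: n; exact: nbhs_infty_gt.
  have [] // := Rintegral_finite_valued P (fun z => g (grid_vector R z))
    (fun z : grid k => measurable_sample_grid n (HUind n n0) z).
- move=> k g.
  apply: (cvg_Rintegral_finite_valued (S := grid k) (Zn := fun n => sample_grid R (U n) n k)
    (Z := limit_grid G V k) (h := fun z => g (grid_vector R z))
    (fun z : grid k => measurable_limit_grid Hind z) _
    (fun z : grid k => prob_limit_grid Hind HG HV z)).
  + near=> n; have n0 : (0 < n)%N by near: n; exact: nbhs_infty_gt.
    by move=> z; exact: (measurable_sample_grid n (HUind n n0) z).
  + move=> z; apply: cvg_trans.
      apply: near_eq_cvg; near=> n.
      have n0 : (0 < n)%N by near: n; exact: nbhs_infty_gt.
      apply/esym; exact: (prob_sample_grid n0 (HUind n n0) (fun j i => @HUunif n j i n0)).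
    (* The law of the sample grid factors over the draws, which reduces its limit to the average
       over a single draw. *)
    apply: cvg_prod_seq => j.
    apply: (avg_cell_valuations_cvg (E := fun p => (z (inord j)).2 (inord p))).
    * by rewrite -ltnS.
    * by move=> p; rewrite -ltnS.
    * exact: iota_uniq.
- by move=> w Nw m; have [h1 h2] := NE w Nw; exact: grid_vector_cvg.
- exact: sample_grid_near_close HUind HUunif.
Unshelve. all: by end_near. Qed.
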